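(* Let $d\in\mathbb{N}$ and let $\tau$ be a $1$-type such that for every $1$-ball $(B,a)\in\tau$, the subgraph of $B$ induced by $V(B)\setminus\{a\}$ is a disjoint union of cliques. Then $\tau$-neighbourhood regularity is uniformly testable on $\mathcal{C}_d$ in constant time.
   Context: $\mathcal{C}_d$ is the class of finite simple undirected graphs of maximum degree at most $d$. For a graph $G$ and vertex $v$, $\mathcal{N}_1^G(v)$ is the subgraph induced by $v$ and its neighbours. A $1$-ball is a pair $(B,b)$ of a graph $B$ and $b\in V(B)$ with every vertex of $B$ at distance at most $1$ from $b$; $1$-balls are isomorphic if some graph isomorphism maps centre to centre. A $1$-type is an isomorphism class of $1$-balls; $v$ has type $\tau$ in $G$ if $(\mathcal{N}_1^G(v),v)\in\tau$. $G$ is $\tau$-neighbourhood regular if every vertex of $G$ has type $\tau$. A graph on $n$ vertices is $\epsilon$-far from a property if more than $\epsilon dn$ edge insertions/deletions are needed to obtain an $n$-vertex graph with the property. The algorithm gets $n$ and oracle access answering queries $(v,i)$, $i\le d$, with the $i$-th neighbour of $v$ (or a special symbol). Uniformly testable in constant time means: there is a single probabilistic algorithm which, given $\epsilon\in(0,1]$, $n$ and oracle access to $G\in\mathcal{C}_d$ on $n$ vertices, accepts with probability at least $2/3$ if $G$ has the property and rejects with probability at least $2/3$ if $G$ is $\epsilon$-far from it, with running time bounded by a function of $\epsilon$ (for fixed $d,\tau$), independent of $n$. *)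

(* Defs.v *)
From HB Require Import structures.
From mathcomp Require Import all_boot all_order all_algebra.
From mathcomp Require Import reals.

Set Implicit Arguments.
Unset Strict Implicit.
Unset Printing Implicit Defensive.

Import Order.TTheory GRing.Theory Num.Theory.

Record sgraph (T : finType) := SGraph {
  adj :> rel T;
  adj_sym : symmetric adj;
  adj_irr : irreflexive adj
}.

Definition max_degree_le (d : nat) (T : finType) (G : sgraph T) : Prop :=
  forall v : T, #|[set u | adj G v u]| <= d.

Section Induced.
Variables (T : finType) (G : sgraph T) (A : {set T}).

Definition induced_adj : rel {x : T | x \in A} :=
  fun x y => adj G (val x) (val y).

Lemma induced_sym : symmetric induced_adj.
Proof. by move=> x y; rewrite /induced_adj adj_sym. Qed.

Lemma induced_irr : irreflexive induced_adj.
Proof. by move=> x; rewrite /induced_adj adj_irr. Qed.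

Definition induced : sgraph {x : T | x \in A} := SGraph induced_sym induced_irr.
End Induced.

Definition disjoint_union_of_cliques (T : finType) (G : sgraph T) : Prop :=
  exists P : {set {set T}}, partition P [set: T] /\
    forall x y : T, adj G x y = (x != y) && (pblock P x == pblock P y).

Record ball1 := Ball1 {
  ball_vertex : finType;
  ball_graph : sgraph ball_vertex;
  centre : ball_vertex;
  ball_radius : forall x, (x == centre) || adj ball_graph centre x
}.

Definition ball_iso (B C : ball1) : Prop :=
  exists f : ball_vertex B -> ball_vertex C,
    [/\ bijective f,
        forall x y, adj (ball_graph C) (f x) (f y) = adj (ball_graph B) x y
      & f (centre B) = centre C].

Definition is_1type (tau : ball1 -> Prop) : Prop :=
  exists B0 : ball1, forall B : ball1, tau B <-> ball_iso B0 B.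

Section Neighbourhood.
Variables (T : finType) (G : sgraph T) (v : T).

Definition closed_nbhd : {set T} := v |: [set u | adj G v u].

Definition nbhd_centre : {x : T | x \in closed_nbhd} :=
  exist _ v (setU11 v [set u | adj G v u]).

Lemma nbhd_radius (x : {x : T | x \in closed_nbhd}) :
  (x == nbhd_centre) || adj (induced G closed_nbhd) nbhd_centre x.
Proof. by have := valP x; rewrite !inE -val_eqE. Qed.

Definition nbhd_ball : ball1 := Ball1 nbhd_radius.
End Neighbourhood.

Definition nbhd_regular (tau : ball1 -> Prop) (T : finType) (G : sgraph T)
  : Prop := forall v : T, tau (nbhd_ball G v).

Definition edges (T : finType) (G : sgraph T) : {set {set T}} :=
  [set [set p.1; p.2] | p in [set p : T * T | adj G p.1 p.2]].

Definition edit_distance (T : finType) (G H : sgraph T) : nat :=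
  #|(edges G :\: edges H) :|: (edges H :\: edges G)|.

(* Graphs on n vertices have vertex set {0, ..., n-1}. If no n-vertex graph has
   the property, then every n-vertex graph is far from it. *)
Definition far (R : realType) (eps : R) (d : nat)
    (P : forall n : nat, sgraph 'I_n -> Prop) (n : nat) (G : sgraph 'I_n)
  : Prop :=
  forall H : sgraph 'I_n, P n H ->
    (eps * d%:R * n%:R < (edit_distance G H)%:R)%R.

(* The neighbours of each vertex are listed in an arbitrary order. *)
Definition adjacency_lists (n : nat) (G : sgraph 'I_n)
    (nbrs : 'I_n -> seq 'I_n) : Prop :=
  forall v : 'I_n, perm_eq (nbrs v) (enum [set u | adj G v u]).

(* Answer to the query (v, i), with i counted from 0. The special symbol is
   encoded by n, which is not the name of a vertex. *)
Definition oracle (n : nat) (nbrs : 'I_n -> seq 'I_n) (v i : nat) : nat :=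
  if insub v is Some w then nth n [seq val u | u <- nbrs w] i else n.

(* Programs of a probabilistic random access machine, in structured form. The
   memory is an array of natural numbers; x, y, z below are addresses, and the
   comments give the effect on the memory M. Each instruction and each test is
   one step. No instruction produces a number larger than a^2, where a >= 2
   bounds n, the constants of the program and the numbers in memory; so a run
   of t steps handles numbers of O_t(log n) bits only, and the unit cost of
   arithmetic is legitimate for constant time. *)
Inductive binop := OpAdd | OpSub | OpMul | OpDiv | OpMod.

Inductive prog :=
  | Skip
  | Const of nat & nat               (* Const x c    : M[x] := c *)
  | Arith of binop & nat & nat & nat (* Arith o x y z: M[x] := M[y] o M[z] *)
  | Read of nat & nat                (* Read x y     : M[x] := M[M[y]] *)
  | Write of nat & nat               (* Write x y    : M[M[x]] := M[y] *)
  | Random of nat & nat              (* Random x y   : M[x] := uniform in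
                                        {0, ..., M[y]-1}, or 0 if M[y] = 0 *)
  | Query of nat & nat & nat         (* Query x y z  : M[x] := answer to the
                                        query (M[y], M[z]) *)
  | LeEps of nat & nat & nat         (* LeEps x y z  : M[x] :=
                                        [M[y] <= eps * M[z]] *)
  | Seq of prog & prog
  | If of nat & prog & prog          (* tests M[x] != 0 *)
  | While of nat & prog.             (* tests M[x] != 0 *)

Definition binop_eval (o : binop) : nat -> nat -> nat :=
  match o with
  | OpAdd => addn | OpSub => subn | OpMul => muln
  | OpDiv => divn | OpMod => modn
  end.

Definition memory := nat -> nat.

Definition update (m : memory) (x a : nat) : memory :=
  fun y => if y == x then a else m y.

(* What remains to be executed, and the memory. *)
Definition config := (seq prog * memory)%type.

Section Semantics.
Variables (leeps : nat -> nat -> bool) (query : nat -> nat -> nat).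

(* The equiprobable successors of a configuration. *)
Definition step (c : config) : seq config :=
  let m := c.2 in
  if c.1 is p :: k then
    match p with
    | Skip => [:: (k, m)]
    | Const x a => [:: (k, update m x a)]
    | Arith o x y z => [:: (k, update m x (binop_eval o (m y) (m z)))]
    | Read x y => [:: (k, update m x (m (m y)))]
    | Write x y => [:: (k, update m (m x) (m y))]
    | Random x y => [seq (k, update m x r) | r <- iota 0 (maxn 1 (m y))]
    | Query x y z => [:: (k, update m x (query (m y) (m z)))]
    | LeEps x y z => [:: (k, update m x (leeps (m y) (m z)))]
    | Seq p1 p2 => [:: (p1 :: p2 :: k, m)]
    | If x p1 p2 => [:: ((if m x != 0 then p1 else p2) :: k, m)]
    | While x p1 => [:: (if m x != 0 then p1 :: p :: k else k, m)]
    end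
  else [::].

Definition halted (c : config) : bool := nilp c.1.

(* The verdict is left in cell 0, nonzero meaning acceptance. *)
Definition verdict (c : config) : bool := c.2 0 != 0.

Fixpoint halts_within (t : nat) (c : config) : bool :=
  halted c || (if t is t'.+1 then all (halts_within t') (step c) else false).

(* Probability that a run halts within t steps with verdict b. *)
Fixpoint pr_verdict (b : bool) (t : nat) (c : config) : rat :=
  (if halted c then (verdict c == b)%:R
   else if t is t'.+1 then
     (\sum_(c' <- step c) pr_verdict b t' c') / (size (step c))%:R
   else 0)%R.
End Semantics.

(* The input n is in cell 0, all the other cells are 0. *)
Definition initial (p : prog) (n : nat) : config :=
  ([:: p], update (fun=> 0) 0 n).

(* The proximity parameter may be any real number, so the machine accesses it
   by comparing it with fractions. For a rational parameter given by numerator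
   and denominator such a comparison takes two multiplications. *)
Definition eps_compare (R : realType) (eps : R) (a b : nat) : bool :=
  (a%:R <= eps * b%:R)%R.

(* The program p is fixed before eps, n and G; the time bound holds for all
   outcomes of the random choices. *)
Definition uniformly_testable_in_constant_time (R : realType) (d : nat)
    (P : forall n : nat, sgraph 'I_n -> Prop) : Prop :=
  exists (p : prog) (time : R -> nat),
    forall (eps : R), (0 < eps <= 1)%R ->
    forall (n : nat) (G : sgraph 'I_n), max_degree_le d G ->
    forall nbrs : 'I_n -> seq 'I_n, adjacency_lists G nbrs ->
      let run_halts :=
        halts_within (eps_compare eps) (oracle nbrs) (time eps) (initial p n) in
      let pr b :=
        pr_verdict (eps_compare eps) (oracle nbrs) b (time eps)
          (initial p n) in
      [/\ run_halts,
          P n G -> (2 / 3 <= pr true)%R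
        & far eps d P G -> (2 / 3 <= pr false)%R].

(* Main.v *)
(** Let the neighbourhood of the centre in tau consist of cliques with sizes
    listed in [sh]. A graph is tau-regular iff its maximal cliques ("lines")
    meet pairwise in at most one point, contain every triangle, and pass through
    every point in the numbers prescribed by [sh]. Counting incidences, this
    forces k to divide n times the number of k-point lines through a point.

    Conversely, assume these divisibilities and that few vertices are bad. The
    lines consisting of good vertices form a system in which only few points
    lack lines. By divisibility, the missing incidences with k-point lines can
    be grouped k at a time. Write such a group as the first row of a k x k array
    whose other rows are k - 1 lines far away from each other and from the
    group, and replace these lines by the k columns of the array: this fills the
    k missing incidences and creates no new triangle outside the lines. So the
    distance to tau-regularity is at most a constant times the number of bad
    vertices, and it suffices to test the divisibilities and to sample
    O(1/eps) vertices, checking their neighbourhoods. *)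

Require Import Defs.
From HB Require Import structures.
From mathcomp Require Import all_boot all_order all_algebra.
From mathcomp Require Import reals.
From mathcomp Require Import zify ring lra boolp.

Set Implicit Arguments.
Unset Strict Implicit.
Unset Printing Implicit Defensive.

Import Order.TTheory GRing.Theory Num.Theory.

(** * Line systems and switching *)

Section LineSystem.
Variable T : finType.
Implicit Types (L : {set T}) (F : {set {set T}}) (x y z : T).

Definition collinear F : rel T :=
  fun x y => [exists L in F, (x \in L) && (y \in L)].

Definition near F : rel T := fun x y => (x == y) || collinear F x y.

Definition line_count F k x := #|[set L in F | (#|L| == k) && (x \in L)]|.

Definition lines F k := [set L in F | #|L| == k].

(* With z = x this says that two lines meet in at most one point, with z
   different from x that every triangle lies on a line. *)
Definition triangle_closed F := forall L1 L2 x y z,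
  L1 \in F -> L2 \in F -> x \in L1 -> y \in L1 -> y \in L2 -> z \in L2 ->
  x != y -> y != z -> near F x z -> L1 = L2.

Lemma near_sym F : symmetric (near F).
Proof.
move=> x y; rewrite /near eq_sym; congr (_ || _).
by apply/existsP/existsP => -[L /andP[LF /andP[a b]]]; exists L; rewrite LF a b.
Qed.

Lemma near_line F L x y : L \in F -> x \in L -> y \in L -> near F x y.
Proof.
by move=> LF xL yL; apply/orP; right; apply/existsP; exists L; rewrite LF xL.
Qed.

Lemma triangle_closed_linear F : triangle_closed F ->
  forall L1 L2 x y, L1 \in F -> L2 \in F -> x \in L1 -> y \in L1 ->
  x \in L2 -> y \in L2 -> x != y -> L1 = L2.
Proof.
move=> tF L1 L2 x y L1F L2F x1 y1 x2 y2 xy.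
by apply: (tF L1 L2 x y x) => //; [rewrite eq_sym | rewrite /near eqxx].
Qed.

Lemma line_countE F k x :
  line_count F k x = \sum_(L in lines F k) (x \in L).
Proof.
rewrite /line_count -sum1_card big_mkcond [RHS]big_mkcond /=.
by apply: eq_bigr => L _; rewrite !inE; case: (L \in F); case: (x \in L); case: eqP.
Qed.

Lemma sum_line_count F k :
  \sum_x line_count F k x = k * #|lines F k|.
Proof.
under eq_bigr do rewrite line_countE.
rewrite exchange_big /= (eq_bigr (fun=> k)); last first.
  move=> L; rewrite !inE => /andP[_ /eqP <-].
  by rewrite -sum1_card [RHS]big_mkcond; apply: eq_bigr => x _; case: (x \in L).
by rewrite sum_nat_const mulnC.
Qed.

(** * Switching an array of points *)

Section Switch.
Variables (F : {set {set T}}) (k : nat) (A : 'I_k.+1 -> 'I_k.+1 -> T).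
Hypothesis k_gt0 : 0 < k.
Hypothesis tF : triangle_closed F.

Definition row j := [set A j i | i in 'I_k.+1].
Definition col i := [set A j i | j in 'I_k.+1].
Definition removed := [set row j | j in [set~ ord0]].
Definition added := [set col i | i in 'I_k.+1].
Definition switch := (F :\: removed) :|: added.

Hypothesis row_line : forall j, j != ord0 -> row j \in F.
(** Row [ord0] holds the points to be served. It may repeat a point, because a point can lack
    several lines of the same size. *)
Hypothesis row_inj : forall j, j != ord0 -> injective (A j).
(** Entries of different rows are at distance at least three in the collinearity graph. *)
Hypothesis row_sep : forall j j' i i' y,
  near F (A j i) y -> near F (A j' i') y -> j = j'.

Lemma mem_row j i : A j i \in row j. Proof. exact: imset_f. Qed.
Lemma mem_col j i : A j i \in col i. Proof. exact: (imset_f (A^~ i)). Qed.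

Lemma entry_row j j' i i' : A j i = A j' i' -> j = j'.
Proof.
by move=> e; apply: (@row_sep j j' i i' (A j i)); rewrite /near ?e eqxx.
Qed.

Lemma entry_col j j' i i' : j != ord0 -> A j i = A j' i' -> i = i'.
Proof.
by move=> j0 e; have ej := entry_row e; subst j'; apply: row_inj e.
Qed.

Lemma entry_near j j' i i' : near F (A j i) (A j' i') -> j = j'.
Proof.
by move=> n; apply: (row_sep n (i' := i')); rewrite /near eqxx.
Qed.

(** By linearity a line sharing two points with row [j] is that row, which has been removed. *)
Lemma old_line_row L j i i' : L \in F :\: removed -> j != ord0 ->
  A j i \in L -> A j i' \in L -> i = i'.
Proof.
rewrite !inE => /andP[Lr LF] j0 a b; case: (i =P i') => // ii'.
case/negP: Lr; suff -> : L = row j by apply: imset_f; rewrite !inE.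
apply: (triangle_closed_linear tF LF (row_line j0) a b); rewrite ?mem_row //.
by apply/eqP => /(row_inj j0).
Qed.

Lemma near_switch x z : near switch x z ->
  [\/ x = z, exists L, [/\ L \in F :\: removed, x \in L & z \in L]
    | exists i, exists j j', x = A j i /\ z = A j' i].
Proof.
case/orP => [/eqP->|/existsP[L /andP[Ls /andP[xL zL]]]]; first by constructor 1.
case/setUP: Ls xL zL => [Lo|/imsetP[i _ ->]] xL zL.
  by constructor 2; exists L.
case/imsetP: xL => j _ ->; case/imsetP: zL => j' _ ->.
by constructor 3; exists i, j, j'.
Qed.

(** This excludes new triangles with one side on a column and one on a remaining line. An old line
    through [A j i] and [z] would make [z] near two rows. A column through them has [z] in row [j'];
    so it is column [i] and [z] is [A j' i], or [j] is [ord0] and [L] meets row [j'] twice. *)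
Lemma switch_old_new L i j j' z : L \in F :\: removed -> j != j' ->
  A j' i \in L -> z \in L -> A j' i != z -> ~~ near switch (A j i) z.
Proof.
move=> Lo jj' yL zL yz; apply/negP.
have LF : L \in F by case/setDP: Lo.
have nyz : near F (A j' i) z by apply: near_line yL zL.
case/near_switch => [e|[L3 [L3o xL3 zL3]]|[i2 [j2 [j3 [e2 e3]]]]].
- by case/negP: jj'; apply/eqP; apply: (row_sep (i := i) _ nyz); rewrite e /near eqxx.
- case/negP: jj'; apply/eqP; apply: (row_sep (i := i) _ nyz).
  by apply: near_line xL3 zL3; case/setDP: L3o.
have ej := entry_row e2; subst j2.
have ej : j' = j3 by apply: (entry_near (i := i) (i' := i2)); rewrite -e3.
subst j3; have [j0|j0] := eqVneq j ord0; last first.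
  by move: yz; rewrite e3 (entry_col j0 e2) eqxx.
have j'0 : j' != ord0 by rewrite -j0 eq_sym.
move: zL yz; rewrite e3 => zL; rewrite (old_line_row Lo j'0 yL zL).
by rewrite eqxx.
Qed.

(** If [L1] and [L2] are both old and the third side is a column, then [x] and [z] are entries of
    rows near [y], hence of the same row, and coincide. The mixed cases are [switch_old_new]. *)
Lemma switch_triangle_closed : triangle_closed switch.
Proof.
move=> L1 L2 x y z /setUP[o1|/imsetP[i _ e1]] /setUP[o2|/imsetP[i' _ e2]]
  xL1 yL1 yL2 zL2 xy yz nxz.
- have LF1 : L1 \in F by case/setDP: o1.
  have LF2 : L2 \in F by case/setDP: o2.
  have nn : near F x z -> L1 = L2 by apply: tF xy yz.
  case: (near_switch nxz) => [e|[L [Lo xL zL]]|[i [j [j' [e e']]]]].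
  + by apply: nn; rewrite e /near eqxx.
  + by apply: nn; apply: near_line xL zL; case/setDP: Lo.
  apply: nn; suff -> : x = z by rewrite /near eqxx.
  rewrite e e'; congr (A _ _); apply: (row_sep (i := i) (i' := i) (y := y)).
    by rewrite -e; apply: near_line xL1 yL1.
  by rewrite -e'; apply: near_line zL2 yL2.
- subst L2; case/imsetP: yL2 => j' _ ey; case/imsetP: zL2 => j _ ez.
  subst y z; move: nxz; rewrite -[near _ _ _]negbK.
  have -> : near switch x (A j i') = near switch (A j i') x.
    by rewrite near_sym.
  rewrite (switch_old_new o1 _ yL1 xL1) //; last by rewrite eq_sym.
  by apply: contraNneq yz => ->.
- subst L1; case/imsetP: yL1 => j' _ ey; case/imsetP: xL1 => j _ ex.
  subst y x; move: nxz; rewrite -[near _ _ _]negbK.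
  rewrite (switch_old_new o2 _ yL2 zL2) //.
  by apply: contraNneq xy => ->.
subst L1 L2; suff -> : i = i' by [].
case/imsetP: yL1 => j' _ ey; case/imsetP: xL1 => j _ ex.
case/imsetP: yL2 => j2 _ ey2; case/imsetP: zL2 => j'' _ ez.
(* Distinct columns can share a point only in row [ord0], where points may repeat. Then [x] and [z]
   lie in rows that are lines, whose entries determine their column. *)
have ej2 : j' = j2 by apply: (@entry_row _ _ i i'); rewrite -ey.
subst j2; have [j'0|j'0] := eqVneq j' ord0; last first.
  by apply: (entry_col j'0 (j' := j')); rewrite -ey.
have j0 : j != ord0.
  by apply: contraNneq xy => j0; rewrite ex ey j'0 j0.
have j''0 : j'' != ord0.
  by apply: contraNneq yz => j0'; rewrite ez ey2 j'0 j0'.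
case: (near_switch nxz) => [e|[L [Lo xL zL]]|[i2 [j1 [j3 [e e']]]]].
- by apply: (entry_col j0 (j' := j'')); rewrite -ex -ez.
- have ejj : j = j''.
    apply: (@entry_near _ _ i i'); rewrite -ex -ez.
    by apply: near_line xL zL; case/setDP: Lo.
  by subst j''; apply: (old_line_row Lo j0); rewrite -?ex -?ez.
have -> : i = i2 by apply: (entry_col j0 (j' := j1)); rewrite -ex.
by symmetry; apply: (entry_col j''0 (j' := j3)); rewrite -ez.
Qed.

Lemma card_col i : #|col i| = k.+1.
Proof.
by rewrite card_imset ?card_ord // => j j' /entry_row.
Qed.

Lemma card_row j : j != ord0 -> #|row j| = k.+1.
Proof. by move=> j0; rewrite card_imset ?card_ord //; apply: row_inj. Qed.

Let one : 'I_k.+1 := inord 1.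
Let one_neq0 : one != ord0. Proof. by rewrite -val_eqE /= inordK. Qed.

Lemma col_inj : injective col.
Proof.
move=> i i' e; have : A one i \in col i' by rewrite -e mem_col.
by case/imsetP => j _ /(entry_col one_neq0).
Qed.

Lemma row_set_inj : {in [set~ ord0] &, injective row}.
Proof.
move=> j j' _ _ e; have : A j ord0 \in row j' by rewrite -e mem_row.
by case/imsetP => i _ /entry_row.
Qed.

(** A column has entries in at least two rows, and no line of [F] joins different rows. *)
Lemma added_new : [disjoint F & added].
Proof.
rewrite disjoint_sym; apply/pred0P => L /=; apply/negbTE/negP.
case/andP => /imsetP[i _ ->] cF; case/eqP: one_neq0.
by apply: (@entry_near _ _ i i); apply: near_line cF _ _; apply: mem_col.
Qed.

Lemma removed_sub : removed \subset F.
Proof.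
by apply/subsetP => L /imsetP[j]; rewrite !inE => j0 ->; apply: row_line.
Qed.

Lemma card_removed : #|removed| = k.
Proof.
by rewrite card_in_imset ?cardsC1 ?card_ord //; apply: row_set_inj.
Qed.

Lemma card_added : #|added| = k.+1.
Proof. by rewrite card_imset ?card_ord //; apply: col_inj. Qed.

Lemma lines_switch_other k' : k' != k.+1 -> lines switch k' = lines F k'.
Proof.
move=> kk'; apply/setP => L; rewrite !inE.
case: (eqVneq #|L| k') => [Lk|]; rewrite ?andbF ?andbT //.
have -> : (L \in removed) = false.
  apply/negbTE; apply: contra kk' => /imsetP[j]; rewrite !inE => j0 e.
  by rewrite -Lk e card_row.
have -> : (L \in added) = false.
  by apply/negbTE; apply: contra kk' => /imsetP[i _ e]; rewrite -Lk e card_col.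
by rewrite orbF.
Qed.

Lemma sum_row x j : j != ord0 -> \sum_i (A j i == x) = (x \in row j).
Proof.
move=> j0; case: imsetP => [[i _ ->]|nx].
  rewrite (bigD1 i) //= eqxx big1 // => i' ii'.
  by apply/eqP; rewrite eqb0; apply: contra ii' => /eqP/(row_inj j0)->.
by rewrite big1 // => i _; apply/eqP; rewrite eqb0; apply/eqP => e; case: nx; exists i.
Qed.

Lemma sum_col x i : \sum_j (A j i == x) = (x \in col i).
Proof.
case: imsetP => [[j _ ->]|nx].
  rewrite (bigD1 j) //= eqxx big1 // => j' jj'.
  by apply/eqP; rewrite eqb0; apply: contra jj' => /eqP/entry_row->.
by rewrite big1 // => j _; apply/eqP; rewrite eqb0; apply/eqP => e; case: nx; exists j.
Qed.

(** Count the array entries equal to [x] in two ways: columns give the added lines through [x], rows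
    give the removed ones and the occurrences of [x] in row [ord0]. *)
Lemma line_count_switch x :
  line_count switch k.+1 x = line_count F k.+1 x + #|[set i | A ord0 i == x]|.
Proof.
rewrite !line_countE.
have rF : removed \subset lines F k.+1.
  apply/subsetP => L Lr; rewrite inE (subsetP removed_sub) //=.
  by case/imsetP: Lr => j; rewrite !inE => j0 ->; rewrite card_row.
have -> : lines switch k.+1 = (lines F k.+1 :\: removed) :|: added.
  apply/setP => L; rewrite !inE.
  case: (boolP (L \in added)) => [/imsetP[i _ ->]|]; rewrite ?orbT ?orbF.
    by rewrite card_col eqxx.
  by rewrite andbA.
rewrite (eq_bigl [predU lines F k.+1 :\: removed & added]); last first.
  by move=> L; rewrite in_setU.
rewrite bigU /=; last first.
  apply/pred0P => L /=; rewrite !inE.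
  apply/negbTE/negP => /andP[/and3P[_ LF _] La].
  by have := disjointFr added_new LF; rewrite La.
rewrite [in RHS](big_setID removed) /= (setIidPr rF).
rewrite [X in _ = X + _]addnC -addnA; congr (_ + _).
rewrite big_imset /=; last by move=> i i' _ _; apply: col_inj.
rewrite big_imset /=; last exact: row_set_inj.
under eq_bigr do rewrite -sum_col.
rewrite exchange_big /= (bigD1 ord0) //= addnC; congr (_ + _).
  apply: eq_big => [j|j j0]; first by rewrite !inE.
  by rewrite sum_row.
rewrite -sum1_card big_mkcond /= [RHS]big_mkcond /=.
by apply: eq_bigr => i _; rewrite inE; case: eqP.
Qed.

Lemma switch_diff :
  #|(F :\: switch) :|: (switch :\: F)| <= k.*2.+1.
Proof.
apply: leq_trans (leq_card_setU _ _) _.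
rewrite -addnn -addnS leq_add //.
  apply: (@leq_trans #|removed|); last by rewrite card_removed.
  apply: subset_leq_card.
  apply/subsetP => L; rewrite !inE => /andP[a LF].
  by move: a; rewrite LF andbT negb_or negbK => /andP[].
apply: (@leq_trans #|added|); last by rewrite card_added.
apply: subset_leq_card.
apply/subsetP => L; rewrite !inE => /andP[nLF].
by rewrite (negbTE nLF) andbF.
Qed.

End Switch.

(** * Completing an admissible line system *)

Lemma card_bigcup_le (I U : finType) (P : pred I) (B : I -> {set U}) :
  #|\bigcup_(i | P i) B i| <= \sum_(i | P i) #|B i|.
Proof.
elim/big_rec2: _ => [|i m C _ le_m]; first by rewrite cards0.
by apply: leq_trans (leq_card_setU _ _) _; rewrite leq_add2l.
Qed.

(** [c k] is the number of [k]-point lines wanted through every point. *)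
Variable c : nat -> nat.

Definition admissible F := [/\ triangle_closed F, forall L, L \in F -> 1 < #|L|
  & forall k x, line_count F k x <= c k].

Variable K : nat.
Hypothesis c_support : forall k, 0 < c k -> 1 < k < K.

(** For an admissible [F] no subtraction is truncated, and this is the number of missing
    incidences. *)
Definition deficiency F := \sum_(k < K) \sum_x (c k - line_count F k x).
Definition lines_per_point := \sum_(k < K) c k.
Definition near_bound := (lines_per_point * K).+1.

Lemma admissible_line_size F L : admissible F -> L \in F -> #|L| < K.
Proof.
move=> [_ L2 Fc] LF; have [x xL] : exists x, x \in L.
  by apply/card_gt0P; apply: ltn_trans (L2 _ LF).
suff /c_support/andP[] : 0 < c #|L| by [].
apply: leq_trans (Fc #|L| x); apply/card_gt0P; exists L.
by rewrite inE LF eqxx xL.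
Qed.

Lemma card_near F x : admissible F -> #|[set y | near F x y]| <= near_bound.
Proof.
move=> aF; pose S := [set L in F | x \in L].
have sub : [set y | near F x y] \subset x |: \bigcup_(L in S) L.
  apply/subsetP => y; rewrite inE => /orP[/eqP->|/existsP[L]].
    by rewrite !inE eqxx.
  case/andP=> LF /andP[xL yL]; rewrite inE; apply/orP; right.
  by apply/bigcupP; exists L; rewrite ?inE ?LF.
apply: leq_trans (subset_leq_card sub) _.
apply: leq_trans (leq_card_setU _ _) _; rewrite cards1 add1n ltnS.
apply: leq_trans (card_bigcup_le _ _) _.
apply: (@leq_trans (\sum_(L in S) K)).
  apply: leq_sum => L; rewrite inE => /andP[LF _].
  exact: ltnW (admissible_line_size aF LF).
rewrite sum_nat_const leq_mul2r; apply/orP; right.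
have sub2 : S \subset \bigcup_(k < K) [set L in F | (#|L| == k) && (x \in L)].
  apply/subsetP => L; rewrite inE => /andP[LF xL].
  apply/bigcupP; exists (Ordinal (admissible_line_size aF LF)) => //.
  by rewrite inE LF xL eqxx.
apply: leq_trans (subset_leq_card sub2) _.
apply: leq_trans (card_bigcup_le _ _) _.
by apply: leq_sum => k _; case: aF => _ _; apply.
Qed.

(** Each point of [X] blocks at most [c k] lines of this size. *)
Lemma avoiding_line F k (X : {set T}) : admissible F ->
  #|X| * c k < #|lines F k| -> exists2 L, L \in lines F k & [disjoint L & X].
Proof.
move=> aF ltX.
have [/existsP[L /andP[LF LX]]|] := boolP [exists L in lines F k, [disjoint L & X]].
  by exists L.
rewrite negb_exists => /forallP no; move: ltX; rewrite ltnNge => /negP[].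
have sub : lines F k \subset
    \bigcup_(x in X) [set L in F | (#|L| == k) && (x \in L)].
  apply/subsetP => L LF; have := no L; rewrite LF /= => /pred0Pn[x /andP[xL xX]].
  by apply/bigcupP; exists x => //; move: LF; rewrite !inE => /andP[-> ->].
apply: leq_trans (subset_leq_card sub) _.
apply: leq_trans (card_bigcup_le _ _) _.
rewrite -sum_nat_const; apply: leq_sum => x _.
by case: aF => _ _; apply.
Qed.

(** The rows are chosen greedily: the next line avoids all points within distance two of an entry
    chosen so far. There are at most [k.+1 * k.+1] entries, with at most [near_bound * near_bound]
    such points around each. *)
Lemma separated_rows F k (a : 'I_k.+1 -> T) : admissible F ->
  k.+1 * k.+1 * (near_bound * near_bound) * c k.+1 < #|lines F k.+1| ->
  forall m, m <= k -> exists A : nat -> 'I_k.+1 -> T,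
    [/\ A 0 = a,
        forall j, 0 < j <= m ->
          injective (A j) /\ [set A j i | i in 'I_k.+1] \in F
      & forall j j' i i' y, j <= m -> j' <= m ->
          near F (A j i) y -> near F (A j' i') y -> j = j'].
Proof.
move=> aF big; elim=> [|m IH] lt_mk.
  exists (fun=> a); split=> // [j|j j' i i' y]; first by case: j.
  by rewrite !leqn0 => /eqP-> /eqP->.
have [A [A0 Aline Asep]] := IH (ltnW lt_mk).
pose N x := [set y | near F x y].
pose X := \bigcup_(p : 'I_k.+1 * 'I_k.+1) \bigcup_(w in N (A p.1 p.2)) N w.
have cardX : #|X| <= k.+1 * k.+1 * (near_bound * near_bound).
  apply: leq_trans (card_bigcup_le _ _) _.
  have -> : k.+1 * k.+1 = #|{: 'I_k.+1 * 'I_k.+1}| by rewrite card_prod !card_ord.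
  rewrite -sum_nat_const; apply: leq_sum => p _.
  apply: leq_trans (card_bigcup_le _ _) _.
  apply: (@leq_trans (\sum_(w in N (A p.1 p.2)) near_bound)).
    by apply: leq_sum => w _; apply: card_near.
  by rewrite sum_nat_const leq_mul2r card_near ?orbT.
have [|L] := @avoiding_line F k.+1 X aF.
  by apply: leq_ltn_trans big; rewrite leq_mul2r cardX orbT.
rewrite inE => /andP[LF /eqP Lk] LX.
pose row i := nth (a ord0) (enum L) (i : 'I_k.+1).
have szL : size (enum L) = k.+1 by rewrite -cardE.
have rowL i : row i \in L by rewrite -mem_enum mem_nth // szL.
have farL j i i' y : j <= m -> near F (A j i) y -> ~~ near F (row i') y.
  move=> jm n1; apply/negP => n2; have := disjointFr LX (rowL i').
  case/negP; apply/bigcupP.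
  have jk : j < k.+1 by apply: leq_ltn_trans jm (leqW lt_mk).
  exists (Ordinal jk, i) => //=.
  by apply/bigcupP; exists y; rewrite inE // near_sym.
exists (fun j => if j == m.+1 then row else A j); split=> //.
- move=> j /andP[j0]; rewrite leq_eqVlt; case: eqP => [-> _|_ /=]; last first.
    by rewrite ltnS => jm; apply: Aline; rewrite j0.
  split=> [i i' /eqP|].
    rewrite nth_uniq ?szL ?ltn_ord ?enum_uniq //.
    by move=> /eqP e; apply: val_inj.
  suff -> : [set row i | i in 'I_k.+1] = L by [].
  apply/eqP; rewrite eqEcard; apply/andP; split.
    by apply/subsetP => x /imsetP[i _ ->].
  rewrite card_imset ?card_ord ?Lk // => i i' /eqP.
  rewrite nth_uniq ?szL ?ltn_ord ?enum_uniq //.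
  by move=> /eqP e; apply: val_inj.
move=> j j' i i' y; rewrite (leq_eqVlt j) (leq_eqVlt j').
case: eqP => [->|_] /= jm; case: eqP => [->|_] //= j'm; rewrite ?ltnS in jm j'm *.
- by move=> n1 n2; move: (farL _ _ i _ j'm n2); rewrite n1.
- by move=> n1 n2; move: (farL _ _ i' _ jm n1); rewrite n2.
exact: Asep.
Qed.

(** List each [x] with multiplicity [w x] and take the first [k.+1] items. *)
Lemma slots (w : T -> nat) k : k < \sum_x w x ->
  exists a : 'I_k.+1 -> T, forall x, #|[set i | a i == x]| <= w x.
Proof.
pose l := flatten [seq nseq (w x) x | x <- enum T].
have <- : size l = \sum_x w x.
  rewrite size_flatten /shape -map_comp sumnE big_map big_enum /=.
  by apply: eq_bigr => x _; rewrite size_nseq.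
have cntl x : count_mem x l = w x.
  rewrite count_flatten -map_comp sumnE big_map big_enum /= (bigD1 x) //=.
  rewrite count_nseq /= eqxx mul1n big1 ?addn0 // => y yx.
  by rewrite count_nseq /= (negbTE yx).
move=> lt_k; have [x0 _] : exists x0, x0 \in l.
  by case: (l) lt_k => // x0 l' _; exists x0; rewrite mem_head.
exists (fun i => nth x0 l i) => x; rewrite -cntl.
have -> : #|[set i : 'I_k.+1 | nth x0 l i == x]| = count_mem x (take k.+1 l).
  rewrite cardsE cardE size_filter -(map_nth_iota0 x0) // count_map.
  by rewrite -val_enum_ord enumT count_map; apply: eq_count => i; rewrite inE.
by rewrite -{2}(cat_take_drop k.+1 l) count_cat leq_addr.
Qed.

(** It makes the missing incidences with [k]-point lines a multiple of [k] as soon as [k] divides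
    [#|T| * c k]. *)
Lemma deficiency_count F k : admissible F ->
  \sum_x (c k - line_count F k x) = #|T| * c k - k * #|lines F k|.
Proof.
by move=> [_ _ Fc]; rewrite sumnB // sum_nat_const sum_line_count.
Qed.

(** The second factor bounds the points that a new row must avoid; the first converts lines into
    incidences. *)
Definition switch_bound := K * (K * K * (near_bound * near_bound)).

(* One switch removes #|L| - 1 lines and adds #|L| of them, so it fills #|L|
   deficient slots at bounded cost. *)
Lemma deficiency_step F : admissible F ->
  (forall k, k %| #|T| * c k) -> 0 < deficiency F ->
  switch_bound + deficiency F < #|T| ->
  exists F', [/\ admissible F', deficiency F' < deficiency F
    & #|(F :\: F') :|: (F' :\: F)| <= K.*2].
Proof.
move=> aF dvd def_gt0 big.
have [k0 k0_def] : exists k : 'I_K, 0 < \sum_x (c k - line_count F k x).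
  apply/existsP; move: def_gt0; apply: contraTT; rewrite negb_exists.
  move/forallP=> no; rewrite -eqn0Ngt; apply/eqP; apply: big1 => k _.
  by apply/eqP; rewrite eqn0Ngt.
have ck0 : 0 < c k0.
  move: k0_def; apply: contraTT; rewrite -!eqn0Ngt => /eqP->.
  by apply/eqP; apply: big1.
have def_le : \sum_x (c k0 - line_count F k0 x) <= deficiency F.
  by rewrite /deficiency (bigD1 k0) //= leq_addr.
have k0_sup := c_support ck0.
case: (k0 : nat) (ltn_ord k0) k0_sup ck0 k0_def def_le => // k lt_kK.
move=> /andP[k_gt0 _] ck k_def def_le {k0}.
(* The number of missing incidences is a positive multiple of [k.+1], so they fill row [ord0]. *)
have lt_k : k < \sum_x (c k.+1 - line_count F k.+1 x).
  apply: dvdn_leq => //; rewrite deficiency_count //.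
  by apply: dvdn_sub => //; apply: dvdn_mulr.
have [a a_slots] := slots lt_k.
(* Of the [#|T| * c k.+1] wanted incidences at most [deficiency F] are missing, which leaves more
   than [switch_bound * c k.+1]. *)
have many : k.+1 * k.+1 * (near_bound * near_bound) * c k.+1 < #|lines F k.+1|.
  rewrite -(ltn_pmul2l (ltn0Sn k)).
  have E : k.+1 * #|lines F k.+1| + \sum_x (c k.+1 - line_count F k.+1 x)
      = #|T| * c k.+1.
    rewrite deficiency_count // subnKC // -sum_line_count.
    by rewrite -sum_nat_const; apply: leq_sum => x _; case: aF.
  have le1 : k.+1 * (k.+1 * k.+1 * (near_bound * near_bound)) <= switch_bound.
    have kK : k.+1 <= K by apply: ltnW.
    by do 2!apply: leq_mul => //; apply: leq_mul.
  have : (switch_bound + deficiency F) * c k.+1 < #|T| * c k.+1.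
    by rewrite ltn_pmul2r.
  rewrite -E mulnDl => lt2.
  have le3 : \sum_x (c k.+1 - line_count F k.+1 x) <= deficiency F * c k.+1.
    by apply: leq_trans def_le _; rewrite leq_pmulr.
  have le4 : k.+1 * (k.+1 * k.+1 * (near_bound * near_bound) * c k.+1)
      <= switch_bound * c k.+1 by rewrite mulnA leq_mul2r le1 orbT.
  lia.
have [A [A0 Aline Asep]] := separated_rows a aF many (leqnn k).
pose B (j : 'I_k.+1) := A j.
have [tF F2 Fc] := aF.
have B_line (j : 'I_k.+1) : j != ord0 -> row B j \in F.
  by move=> j0; case: (Aline j) => //; rewrite lt0n -ltnS ltn_ord j0.
have B_inj (j : 'I_k.+1) : j != ord0 -> injective (B j).
  by move=> j0; case: (Aline j) => //; rewrite lt0n -ltnS ltn_ord j0.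
have B_sep j j' i i' y : near F (B j i) y -> near F (B j' i') y -> j = j'.
  by move=> n1 n2; apply: val_inj; apply: Asep n1 n2; rewrite -ltnS.
have cnt x k' : line_count (switch F B) k' x =
    line_count F k' x + (k' == k.+1) * #|[set i | a i == x]|.
  case: eqP => [->|/eqP kk']; last first.
    by rewrite !line_countE lines_switch_other // addn0.
  by rewrite line_count_switch // mul1n /B /= A0.
exists (switch F B); split.
- split; first exact: switch_triangle_closed.
    move=> L /setUP[/setDP[/F2]//|/imsetP[i _ ->]].
    by rewrite (card_col B_sep).
  move=> k' x; rewrite cnt; case: eqP => [->|_]; last by rewrite addn0.
  by rewrite mul1n -leq_subRL.
- rewrite /deficiency (bigD1 (Ordinal lt_kK)) //= [X in _ < X](bigD1 (Ordinal lt_kK)) //=.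
  rewrite -addSn leq_add //; last first.
    by apply: leq_sum => k' _; apply: leq_sum => x _; rewrite cnt leq_sub2l ?leq_addr.
  rewrite (bigD1 (a ord0)) //= [X in _ < X](bigD1 (a ord0)) //= -addSn leq_add //.
    have pos : 0 < #|[set i | a i == a ord0]|.
      by apply/card_gt0P; exists ord0; rewrite inE.
    have := a_slots (a ord0); rewrite cnt eqxx mul1n; lia.
  by apply: leq_sum => x _; rewrite cnt leq_sub2l ?leq_addr.
apply: leq_trans (@switch_diff F k B _ _ _) _ => //.
by move: lt_kK; lia.
Qed.

(** Iterate [deficiency_step], at most [m] times. The size hypothesis survives because the
    deficiency drops, and the changes add up by the triangle inequality for symmetric
    differences. *)
Lemma completion m F : admissible F ->
  (forall k, k %| #|T| * c k) -> deficiency F <= m ->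
  switch_bound + deficiency F < #|T| ->
  exists F', [/\ admissible F', forall k x, line_count F' k x = c k
    & #|(F :\: F') :|: (F' :\: F)| <= K.*2 * m].
Proof.
elim: m F => [|m IH] F aF dvd le_m big.
  exists F; split=> // [k x|]; last by rewrite setDv setU0 cards0.
  have [_ _ Fc] := aF; apply/eqP; rewrite eqn_leq Fc /=.
  have [ck|] := posnP (c k); first by rewrite ck.
  move=> /c_support/andP[_ kK]; move: le_m; rewrite leqn0 sum_nat_eq0.
  move/forallP=> /(_ (Ordinal kK)) /=; rewrite sum_nat_eq0.
  by move/forallP => /(_ x).
have [def0|def_gt0] := posnP (deficiency F).
  have [|F' [aF' cF' leF']] := IH F aF dvd _ big; first by rewrite def0.
  by exists F'; split=> //; apply: leq_trans leF' _; rewrite leq_mul2l leqnSn orbT.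
have [F1 [aF1 lt1 le1]] := deficiency_step aF dvd def_gt0 big.
have [| |F' [aF' cF' leF']] := IH F1 aF1 dvd.
- by rewrite -ltnS; apply: leq_trans lt1 _.
- by apply: leq_ltn_trans big; rewrite leq_add2l ltnW.
exists F'; split=> //.
have sub : (F :\: F') :|: (F' :\: F) \subset
    ((F :\: F1) :|: (F1 :\: F)) :|: ((F1 :\: F') :|: (F' :\: F1)).
  apply/subsetP => L; rewrite !inE.
  by case: (L \in F); case: (L \in F'); case: (L \in F1).
apply: leq_trans (subset_leq_card sub) _.
apply: leq_trans (leq_card_setU _ _) _.
by rewrite mulnS leq_add.
Qed.

End LineSystem.

(** * Neighbourhoods that are unions of cliques *)

Section CliqueBlocks.
Variables (T : eqType) (e : rel T).
Implicit Type ss : seq (seq T).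

(** An index out of range yields the empty list and imposes nothing. *)
Definition clique_blocks ss := forall a b x y,
  x \in nth [::] ss a -> y \in nth [::] ss b -> e x y = (x != y) && (a == b).

(** The adjacency expected between positions [i] and [j] of the concatenated blocks. It depends on
    the block sizes alone, so it can be built into a program. *)
Definition same_block (sh : seq nat) (i j : nat) :=
  (i != j) && (reshape_index sh i == reshape_index sh j).

Lemma mem_nth_flatten x0 ss i : i < size (flatten ss) ->
  nth x0 (flatten ss) i \in nth [::] ss (reshape_index (shape ss) i).
Proof.
rewrite size_flatten => lt_i; rewrite nth_flatten mem_nth //.
rewrite -(nth_map _ 0) -/(shape ss); first exact: reshape_offsetP.
by rewrite -(size_map size) -/(shape ss); apply: reshape_indexP.
Qed.

Lemma nth_block_flatten x0 ss a x : x \in nth [::] ss a ->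
  exists2 i, i < size (flatten ss)
    & nth x0 (flatten ss) i = x /\ reshape_index (shape ss) i = a.
Proof.
move=> xa; have lt_a : a < size ss.
  by rewrite ltnNge; apply/negP => le; move: xa; rewrite nth_default.
have lt_x : index x (nth [::] ss a) < nth 0 (shape ss) a.
  by rewrite (nth_map [::]) // index_mem.
exists (flatten_index (shape ss) a (index x (nth [::] ss a))).
  by rewrite size_flatten flatten_indexP.
by rewrite nth_flatten flatten_indexKl // flatten_indexKr // nth_index.
Qed.

Lemma clique_blocksP x0 ss : uniq (flatten ss) ->
  clique_blocks ss <-> forall i j,
    i < size (flatten ss) -> j < size (flatten ss) ->
    e (nth x0 (flatten ss) i) (nth x0 (flatten ss) j)
      = same_block (shape ss) i j.
Proof.
move=> u; split=> [cb i j lt_i lt_j|pat a b x y].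
  by rewrite (cb _ _ _ _ (mem_nth_flatten x0 lt_i) (mem_nth_flatten x0 lt_j))
    nth_uniq.
move=> /(nth_block_flatten x0)[i lt_i [<- <-]].
move=> /(nth_block_flatten x0)[j lt_j [<- <-]].
by rewrite pat // nth_uniq.
Qed.

Lemma uniq_flatten_map (I : eqType) (s : seq I) (f : I -> seq T) :
  uniq s -> {in s, forall i, uniq (f i)} ->
  {in s &, forall i j x, x \in f i -> x \in f j -> i = j} ->
  uniq (flatten (map f s)).
Proof.
elim: s => //= i s IH /andP[i_s us] uf inj.
rewrite cat_uniq uf ?mem_head // IH //; first last.
- by move=> j k js ks; apply: inj; rewrite inE ?js ?ks orbT.
- by move=> j js; apply: uf; rewrite inE js orbT.
rewrite andbT; apply/hasPn => x /flattenP[l /mapP[j js ->] xj].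
apply: contra i_s => xi.
by rewrite (inj i j _ _ x) ?mem_head // inE js orbT.
Qed.

Lemma clique_blocks_map (I : eqType) (s : seq I) (f : I -> seq T) :
  uniq s ->
  {in s &, forall i j x y, x \in f i -> y \in f j ->
     e x y = (x != y) && (i == j)} ->
  clique_blocks (map f s).
Proof.
move=> us ef a b x y xa yb.
have lt_a : a < size s.
  by rewrite -(size_map f) ltnNge; apply/negP => le; move: xa; rewrite nth_default.
have lt_b : b < size s.
  by rewrite -(size_map f) ltnNge; apply/negP => le; move: yb; rewrite nth_default.
case: s us ef lt_a lt_b xa yb => // i0 s us ef lt_a lt_b.
rewrite !(nth_map i0) // => xa yb.
by rewrite (ef _ _ _ _ _ _ xa yb) ?mem_nth // nth_uniq.
Qed.

End CliqueBlocks.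

Section GoodVertex.
Variable sh : seq nat.

Definition good (T : finType) (G : sgraph T) (v : T) := exists ss,
  [/\ shape ss = sh, uniq (flatten ss),
      forall x, (x \in flatten ss) = adj G v x
    & clique_blocks (adj G) ss].

(** This turns goodness into a finite search over the orderings [Is] of the neighbours, whatever the
    order in which they are listed. *)
Lemma good_listP (T : finType) (G : sgraph T) (v : T) (l : seq T) :
  perm_eq l (enum [set u | adj G v u]) ->
  good G v <-> size l = sumn sh /\
    exists2 Is, perm_eq Is (iota 0 (size l))
      & forall i j, i < size l -> j < size l ->
        adj G (nth v l (nth 0 Is i)) (nth v l (nth 0 Is j)) = same_block sh i j.
Proof.
move=> pl; have ul : uniq l by rewrite (perm_uniq pl) enum_uniq.
have lE x : (x \in l) = adj G v x by rewrite (perm_mem pl) mem_enum inE.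
split=> [[ss [ssE u ssv cb]]|[szl [Is pI pat]]].
  have ps : perm_eq (flatten ss) l.
    by apply: uniq_perm => // x; rewrite ssv lE.
  have szs := perm_size ps.
  split; first by rewrite -szs size_flatten ssE.
  have /(perm_iotaP v)[Is pI sE] := ps; exists Is => // i j lt_i lt_j.
  have szI : size Is = size l by rewrite (perm_size pI) size_iota.
  rewrite -!(nth_map _ v) ?szI // -sE -ssE.
  by apply clique_blocksP; rewrite ?szs.
have szI : size Is = size l by rewrite (perm_size pI) size_iota.
pose s := [seq nth v l i | i <- Is].
have ps : perm_eq s l by apply/(perm_iotaP v); exists Is.
have szs : size s = sumn sh by rewrite (perm_size ps).
exists (reshape sh s).
have fE : flatten (reshape sh s) = s by rewrite reshapeKr ?szs.
have hE : shape (reshape sh s) = sh by rewrite reshapeKl ?szs.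
have us : uniq s by rewrite (perm_uniq ps).
split; rewrite ?fE //; first by move=> x; rewrite (perm_mem ps) lE.
apply: (proj2 (clique_blocksP (adj G) v _)); rewrite fE // hE szs -szl.
move=> i j lt_i lt_j.
by rewrite !(nth_map 0) ?szI // pat.
Qed.

Variables (B : ball1) (ss0 : seq (seq (ball_vertex B))).
Hypothesis ss0_shape : shape ss0 = sh.
Hypothesis ss0_uniq : uniq (flatten ss0).
Hypothesis ss0_mem : flatten ss0 =i [set~ centre B].
Hypothesis ss0_blocks : clique_blocks (adj (ball_graph B)) ss0.

Lemma adj_centre x : adj (ball_graph B) (centre B) x = (x != centre B).
Proof.
by have := ball_radius x; case: eqP => [-> _|//]; rewrite adj_irr.
Qed.

(** Listed block by block, both neighbourhoods show the pattern [same_block sh], so matching centres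
    and positions is an isomorphism. Conversely, an isomorphism transports the blocks. *)
Lemma good_ball_iso (T : finType) (G : sgraph T) v :
  good G v <-> ball_iso B (nbhd_ball G v).
Proof.
split=> [[ss [ssE us ssv cb]]|[f [bf ef fc]]]; last first.
  pose g x := val (f x).
  have g_inj : injective g by move=> x y /val_inj; apply: bij_inj.
  have nth_g a : nth [::] (map (map g) ss0) a = map g (nth [::] ss0 a).
    have [lt_a|le_a] := ltnP a (size ss0); first by rewrite (nth_map [::]).
    by rewrite !nth_default ?size_map.
  have adj_g x y : adj G (g x) (g y) = adj (ball_graph B) x y by rewrite -ef.
  exists (map (map g) ss0); split.
  - rewrite -ss0_shape /shape -map_comp; apply: eq_map => l /=.
    by rewrite size_map.
  - by rewrite -map_flatten map_inj_uniq.
  - move=> x; rewrite -map_flatten; apply/mapP/idP => [[y]|].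
      rewrite ss0_mem !inE => yc ->; have := adj_g (centre B) y.
      by rewrite adj_centre yc /g fc.
    move=> vx; have xN : x \in closed_nbhd G v by rewrite !inE vx orbT.
    have [f' ff' f'f] := bf.
    exists (f' (exist _ x xN)); last by rewrite /g f'f.
    rewrite ss0_mem !inE; apply/eqP => e.
    have := f'f (exist _ x xN); rewrite e fc => /(congr1 val) /= vE.
    by move: vx; rewrite -vE adj_irr.
  move=> a b x y; rewrite !nth_g => /mapP[x' xa ->] /mapP[y' yb ->].
  by rewrite adj_g (ss0_blocks xa yb) (inj_eq g_inj).
pose s0 := flatten ss0; have u0 : uniq s0 := ss0_uniq.
set s := flatten ss in us ssv.
have szs : size s = size s0 by rewrite !size_flatten ssE ss0_shape.
have patG : forall i j, i < size s -> j < size s ->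
    adj G (nth v s i) (nth v s j) = same_block sh i j.
  by rewrite -ssE; apply clique_blocksP.
have patB : forall i j, i < size s0 -> j < size s0 ->
    adj (ball_graph B) (nth (centre B) s0 i) (nth (centre B) s0 j)
      = same_block sh i j.
  by rewrite -ss0_shape; apply clique_blocksP.
have vs : v \notin s by rewrite ssv adj_irr.
have cs : centre B \notin s0 by rewrite /s0 ss0_mem !inE eqxx.
have s0E x : (x \in s0) = (x != centre B) by rewrite /s0 ss0_mem !inE.
pose F x := if x == centre B then v else nth v s (index x s0).
have Fs x : x != centre B -> F x \in s.
  by move=> xc; rewrite /F (negbTE xc) mem_nth // szs index_mem s0E.
have FP x : F x \in closed_nbhd G v.
  rewrite !inE; have [->|xc] := eqVneq x (centre B); first by rewrite /F !eqxx.
  by have := Fs _ xc; rewrite ssv => ->; rewrite orbT.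
pose g (y : {x | x \in closed_nbhd G v}) :=
  if val y == v then centre B else nth (centre B) s0 (index (val y) s).
exists (fun x => exist _ (F x) (FP x)); split.
- exists g => [x|y].
    rewrite /g /=; have [->|xc] := eqVneq x (centre B); first by rewrite /F !eqxx.
    have := Fs _ xc; have -> : (F x == v) = false.
      by apply/eqP => e; move: (Fs _ xc); rewrite e (negbTE vs).
    rewrite /F (negbTE xc) => _; rewrite index_uniq ?szs ?index_mem ?s0E //.
    by rewrite nth_index // s0E.
  apply: val_inj => /=; rewrite /F /g.
  have [->|yv] := eqVneq (val y) v; first by rewrite eqxx.
  have ys : val y \in s by have := valP y; rewrite !inE (negbTE yv) ssv.
  rewrite -{1}(negbK (_ == _)) -s0E mem_nth ?index_mem -?szs ?index_mem //=.
  by rewrite index_uniq ?nth_index // -szs index_mem.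
- have sym a b : adj G (F a) (F b) = adj G (F b) (F a) by rewrite adj_sym.
  have cen y : adj G (F (centre B)) (F y) = adj (ball_graph B) (centre B) y.
    rewrite adj_centre {1}/F eqxx; have [->|yc] := eqVneq y (centre B).
      by rewrite /F eqxx adj_irr.
    by have := Fs _ yc; rewrite ssv.
  move=> x y /=; rewrite /induced_adj /=.
  have [->|xc] := eqVneq x (centre B); first exact: cen.
  have [->|yc] := eqVneq y (centre B).
    by rewrite sym cen adj_sym.
  rewrite /F (negbTE xc) (negbTE yc) patG ?szs ?index_mem ?s0E //.
  by rewrite -patB ?index_mem ?s0E // !nth_index ?s0E.
by apply: val_inj; rewrite /= /F eqxx.
Qed.

End GoodVertex.

Lemma clique_ball_blocks (B : ball1) :
  disjoint_union_of_cliques (induced (ball_graph B) [set~ centre B]) ->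
  exists ss : seq (seq (ball_vertex B)),
    [/\ 0 \notin shape ss, uniq (flatten ss), flatten ss =i [set~ centre B]
      & clique_blocks (adj (ball_graph B)) ss].
Proof.
move=> [P [/and3P[/eqP covP tiP P0] PE]].
have pbE A x : A \in P -> x \in A -> pblock P x = A.
  by move=> AP xA; apply: def_pblock tiP AP xA.
exists [seq [seq val x | x <- enum A] | A : {set _} <- enum P]; split.
- apply/negP => /mapP[l /mapP[A]]; rewrite mem_enum => AP ->.
  rewrite size_map -cardE => /esym/eqP; rewrite cards_eq0 => /eqP A0.
  by rewrite -A0 AP in P0.
- apply: uniq_flatten_map; rewrite ?enum_uniq //.
    by move=> A _; rewrite map_inj_uniq ?enum_uniq //; apply: val_inj.
  move=> A A'; rewrite !mem_enum => AP AP' x /mapP[y + ->] /mapP[z + /val_inj e].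
  by rewrite !mem_enum -e => yA yA'; rewrite -(pbE A y) // -(pbE A' y).
- move=> x; apply/flattenP/idP => [[l /mapP[A _ ->] /mapP[y _ ->]]|xc].
    exact: valP.
  pose y : {x | x \in [set~ centre B]} := exist _ x xc.
  have yP : y \in cover P by rewrite covP inE.
  exists [seq val x | x <- enum (pblock P y)].
    by apply: (map_f (fun A : {set _} => [seq val x | x <- enum A]));
      rewrite mem_enum pblock_mem.
  by apply/mapP; exists y => //; rewrite mem_enum mem_pblock.
apply: clique_blocks_map; rewrite ?enum_uniq //.
move=> A A'; rewrite !mem_enum => AP AP' x y /mapP[x' + ->] /mapP[y' + ->].
rewrite !mem_enum => xA yA; have := PE x' y'.
by rewrite /= /induced_adj (pbE A) // (pbE A') // (inj_eq val_inj).
Qed.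

(** * Repairing a graph with few bad vertices *)

Lemma count_enum (T : finType) (A : {set T}) (p : pred T) :
  count p (enum A) = #|[set x in A | p x]|.
Proof.
rewrite -size_filter cardE; apply: perm_size; apply: uniq_perm.
- exact: filter_uniq (enum_uniq _).
- exact: enum_uniq.
by move=> x; rewrite mem_filter !mem_enum inE andbC.
Qed.

Section LineGraph.
Variables (T : finType) (F : {set {set T}}).

Definition line_adj : rel T := fun x y => (x != y) && collinear F x y.

Lemma line_adj_sym : symmetric line_adj.
Proof.
move=> x y; rewrite /line_adj eq_sym; case: eqP => //= /eqP xy.
by have := near_sym F x y; rewrite /near eq_sym (negbTE xy).
Qed.

Lemma line_adj_irr : irreflexive line_adj.
Proof. by move=> x; rewrite /line_adj eqxx. Qed.

Definition line_graph := SGraph line_adj_sym line_adj_irr.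

End LineGraph.

Section Repair.
Variable sh : seq nat.
Hypothesis sh_pos : 0 \notin sh.

(* The number of lines of size k, that is of cliques with k - 1 vertices in the
   neighbourhood, through each point. *)
Definition line_quota k := count_mem k (map S sh).
(** A block has at most [sumn sh] vertices; one more is for the centre, another makes the bound
    strict. *)
Definition size_bound := (sumn sh).+2.

Lemma line_quota_support k : 0 < line_quota k -> 1 < k < size_bound.
Proof.
rewrite -has_count has_pred1 => /mapP[s s_sh ->]; rewrite !ltnS; apply/andP; split.
  by rewrite lt0n; apply: contraNneq sh_pos => <-.
by rewrite sumnE (big_rem s) //= leq_addr.
Qed.

(** The blocks at [v] are the lines through [v] with [v] deleted; triangle closure forbids edges
    between two of them. *)
Lemma line_graph_good (T : finType) (F : {set {set T}}) v :
  triangle_closed F -> (forall L, L \in F -> 1 < #|L|) ->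
  (forall k x, line_count F k x = line_quota k) ->
  good sh (line_graph F) v.
Proof.
move=> tF F2 Fc; pose Fv := enum [set L in F | v \in L].
have FvE L : (L \in Fv) = (L \in F) && (v \in L) by rewrite mem_enum inE.
have pFv : perm_eq sh [seq #|L : {set T}|.-1 | L <- Fv].
  rewrite perm_sym; unlock perm_eq; apply/allP => s _; apply/eqP.
  transitivity (line_quota s.+1); last first.
    by rewrite /line_quota count_map; apply: eq_count => i /=; rewrite eqSS.
  rewrite -(Fc _ v) count_map count_enum; congr #|pred_of_set _|.
  apply/setP => L; rewrite !inE -andbA; case LF: (L \in F) => //=.
  by rewrite andbC -(prednK (ltnW (F2 _ LF))).
(* [Is] puts the lines through [v] in the order of the sizes in [sh]. *)
have /(perm_iotaP 0)[Is pI shE] := pFv; rewrite size_map in pI.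
pose ls := [seq nth set0 Fv i | i <- Is].
have pls : perm_eq ls Fv by apply/(perm_iotaP set0); exists Is.
have lsE L : (L \in ls) = (L \in F) && (v \in L) by rewrite (perm_mem pls) FvE.
have uls : uniq ls by rewrite (perm_uniq pls) enum_uniq.
have shls : [seq #|L : {set T}|.-1 | L <- ls] = sh.
  rewrite shE -map_comp; apply/eq_in_map => i; rewrite (perm_mem pI) mem_iota /=.
  by move=> lt_i; rewrite (nth_map set0).
have lin := triangle_closed_linear tF.
exists [seq enum (L :\ v) | L : {set T} <- ls]; split.
- rewrite -shls /shape -map_comp; apply/eq_in_map => L; rewrite lsE => /andP[_ vL] /=.
  by rewrite -cardE (cardsD1 v L) vL.
- apply: uniq_flatten_map => // [L _|L L']; first exact: enum_uniq.
  rewrite !lsE => /andP[LF vL] /andP[LF' vL'] x.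
  rewrite !mem_enum !inE => /andP[xv xL] /andP[_ xL'].
  exact: (lin L L' x v).
- move=> x; apply/flattenP/andP => [[_ /mapP[L + ->]]|[vx /existsP[L]]].
    rewrite lsE mem_enum !inE => /andP[LF vL] /andP[xv xL].
    by rewrite eq_sym; split=> //; apply/existsP; exists L; rewrite LF vL.
  case/andP=> LF /andP[vL xL]; exists (enum (L :\ v)); last first.
    by rewrite mem_enum !inE eq_sym vx.
  by apply: (map_f (fun L : {set T} => enum (L :\ v))); rewrite lsE LF.
apply: clique_blocks_map => // L L'; rewrite !lsE => /andP[LF vL] /andP[LF' vL'] x y.
rewrite !mem_enum !inE => /andP[xv xL] /andP[yv yL] /=; congr (_ && _).
apply/idP/eqP => [xy|e].
  apply: (tF L L' x v y) => //; first by rewrite eq_sym.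
  by rewrite /near xy orbT.
by apply/existsP; exists L; rewrite LF xL e.
Qed.

(** * Lines from maximal cliques *)

Section CliqueLines.
Variables (T : finType) (G : sgraph T).

Definition max_clique (L : {set T}) :=
  [forall x in L, forall y in L, (x != y) ==> adj G x y] &&
  [forall z, (z \notin L) ==> [exists x in L, ~~ adj G z x]].

Lemma max_clique_adj L x y : max_clique L -> x \in L -> y \in L -> x != y ->
  adj G x y.
Proof.
by move=> /andP[/forall_inP/(_ x) cl _] /cl/forall_inP/(_ y) {}cl /cl/implyP.
Qed.

Lemma max_clique_out L z : max_clique L -> z \notin L ->
  exists2 x, x \in L & ~~ adj G z x.
Proof.
by move=> /andP[_ /forallP/(_ z)/implyP m] /m/exists_inP.
Qed.

(** Among the neighbours of a good vertex, being equal or adjacent means lying in the same block. *)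
Lemma good_trans v x y z : good sh G v ->
  adj G v x -> adj G v y -> adj G v z ->
  (x == y) || adj G x y -> (y == z) || adj G y z -> (x == z) || adj G x z.
Proof.
move=> [ss [_ u ssv cb]]; rewrite -!ssv.
move=> /flattenP[_ /(nthP [::])[a _ <-] xa].
move=> /flattenP[_ /(nthP [::])[b _ <-] yb].
move=> /flattenP[_ /(nthP [::])[c _ <-] zc].
case/orP => [/eqP-> //|]; rewrite (cb _ _ _ _ xa yb) => /andP[xy /eqP ab].
case/orP => [/eqP<-|]; rewrite ?(cb _ _ _ _ xa yb) ?xy ?ab ?eqxx ?orbT //.
rewrite (cb _ _ _ _ yb zc) (cb _ _ _ _ xa zc) ab => /andP[_ ->].
by rewrite andbT orbN.
Qed.

(** For [w] in [L1] and [u] in [L2], both different from [v], the chain [w], [x], [y], [u] and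
    [good_trans] make [w] equal or adjacent to [u]. By maximality [w] is in [L2]; the other
    inclusion is symmetric. *)
Lemma good_max_clique_unique v x y L1 L2 : good sh G v ->
  max_clique L1 -> max_clique L2 -> v \in L1 -> v \in L2 ->
  x \in L1 -> y \in L2 -> x != v -> y != v -> (x == y) || adj G x y ->
  L1 = L2.
Proof.
move=> gv.
have sub M1 M2 a b : max_clique M1 -> max_clique M2 -> v \in M1 -> v \in M2 ->
    a \in M1 -> b \in M2 -> a != v -> b != v -> (a == b) || adj G a b ->
    M1 \subset M2.
  move=> m1 m2 v1 v2 a1 b2 av bv ab; apply/subsetP => w w1.
  apply/negPn/negP => w2; have [u u2] := max_clique_out m2 w2.
  have wv : w != v by apply: contraNneq w2 => ->.
  have wu : w != u by apply: contraNneq w2 => ->.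
  have vN M z : max_clique M -> v \in M -> z \in M -> z != v -> adj G v z.
    by move=> mM vM zM zv; rewrite (max_clique_adj mM) // eq_sym.
  case/negP; have [->|uv] := eqVneq u v.
    by rewrite (max_clique_adj m1).
  have wa : (w == a) || adj G w a.
    by case: eqVneq => //= wa; rewrite (max_clique_adj m1).
  have bu : (b == u) || adj G b u.
    by case: eqVneq => //= bu; rewrite (max_clique_adj m2).
  have vw := vN _ _ m1 v1 w1 wv; have vu := vN _ _ m2 v2 u2 uv.
  have va := vN _ _ m1 v1 a1 av; have vb := vN _ _ m2 v2 b2 bv.
  have wb := good_trans gv vw va vb wa ab.
  by have := good_trans gv vw vb vu wb bu; rewrite (negbTE wu).
move=> m1 m2 v1 v2 x1 y2 xv yv xy; apply/eqP; rewrite eqEsubset.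
rewrite (sub _ _ x y) //=; apply: (sub _ _ y x) => //.
by rewrite eq_sym adj_sym.
Qed.

Section Blocks.
Variables (v : T) (ss : seq (seq T)).
Hypothesis ss_shape : shape ss = sh.
Hypothesis ss_uniq : uniq (flatten ss).
Hypothesis ss_adj : forall x, (x \in flatten ss) = adj G v x.
Hypothesis ss_blocks : clique_blocks (adj G) ss.

Definition block a := v |: [set x in nth [::] ss a].

Lemma mem_block_adj a x : x \in nth [::] ss a -> adj G v x.
Proof.
move=> xa; rewrite -ss_adj; apply/flattenP; exists (nth [::] ss a) => //.
by rewrite mem_nth // ltnNge; apply/negP => le; move: xa; rewrite nth_default.
Qed.

Lemma block_unique a b x : x \in nth [::] ss a -> x \in nth [::] ss b -> a = b.
Proof.
move=> /(nth_block_flatten v)[i lt_i [ei <-]].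
move=> /(nth_block_flatten v)[j lt_j [ej <-]].
by congr reshape_index; apply/eqP; rewrite -(nth_uniq v lt_i lt_j ss_uniq) ei ej.
Qed.

Lemma notin_block a : v \notin nth [::] ss a.
Proof. by apply/negP => /mem_block_adj; rewrite adj_irr. Qed.

Lemma size_block a : a < size ss -> size (nth [::] ss a) = nth 0 sh a.
Proof. by move=> lt_a; rewrite -ss_shape (nth_map [::]). Qed.

Lemma block_neq0 a : a < size ss -> exists x, x \in nth [::] ss a.
Proof.
move=> lt_a; have : 0 < size (nth [::] ss a).
  rewrite size_block // lt0n; apply: contraNneq sh_pos => <-.
  by rewrite mem_nth // -ss_shape size_map.
by case: (nth [::] ss a) => // x l _; exists x; rewrite mem_head.
Qed.

Lemma card_block a : a < size ss -> #|block a| = (nth 0 sh a).+1.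
Proof.
move=> lt_a; rewrite cardsU1 inE notin_block add1n -size_block //; congr _.+1.
rewrite cardsE; apply/card_uniqP; move: ss_uniq.
rewrite -{1}(cat_take_drop a ss) flatten_cat cat_uniq => /and3P[_ _].
by rewrite (drop_nth [::]) //= cat_uniq => /and3P[].
Qed.

(** A neighbour of [v] outside the block lies in another one, so it is adjacent to no neighbour of
    [v] in this block; and the block is nonempty because [sh] omits 0. *)
Lemma block_max_clique a : a < size ss -> max_clique (block a).
Proof.
move=> lt_a; apply/andP; split.
  apply/forall_inP => x; rewrite !inE => xa; apply/forall_inP => y; rewrite !inE => ya.
  apply/implyP => xy; case/orP: xa ya => [/eqP ex|xa] /orP[/eqP ey|ya].
  - by rewrite ex ey eqxx in xy.
  - by rewrite ex (mem_block_adj ya).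
  - by rewrite ey adj_sym (mem_block_adj xa).
  by rewrite (ss_blocks xa ya) xy eqxx.
apply/forallP => z; apply/implyP; rewrite !inE negb_or => /andP[zv za].
case vz : (adj G v z); last first.
  by apply/exists_inP; exists v; rewrite ?setU11 // adj_sym vz.
have [x xa] := block_neq0 lt_a.
apply/exists_inP; exists x; first by rewrite !inE xa orbT.
move: vz; rewrite -ss_adj => /flattenP[_ /(nthP [::])[b _ <-] zb].
rewrite (ss_blocks zb xa) negb_and; apply/orP; right.
by apply: contraNneq za => <-.
Qed.

Lemma max_clique_block L : max_clique L -> v \in L -> 1 < #|L| ->
  exists2 a, a < size ss & L = block a.
Proof.
move=> mL vL; rewrite (cardsD1 v) vL ltnS => /card_gt0P[x].
rewrite !inE => /andP[xv xL].
have : adj G v x by rewrite (max_clique_adj mL) // eq_sym.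
rewrite -ss_adj => /flattenP[_ /(nthP [::])[a lt_a <-] xa]; exists a => //.
have gv : good sh G v by exists ss.
apply: (good_max_clique_unique gv mL (block_max_clique lt_a) vL _ xL _ xv xv).
- exact: setU11.
- by rewrite !inE xa orbT.
by rewrite eqxx.
Qed.

(** The maximal cliques through [v] with at least two vertices are the blocks at [v] enlarged by
    [v]. *)
Lemma card_max_cliques k : 1 < k ->
  #|[set L | max_clique L & (#|L| == k) && (v \in L)]| = line_quota k.
Proof.
move=> k_gt1; have szss : size ss = size sh by rewrite -ss_shape size_map.
have -> : [set L | max_clique L & (#|L| == k) && (v \in L)] =
    [set block (nat_of_ord a) | a in [set a : 'I_(size sh) | (nth 0 sh a).+1 == k]].
  apply/setP => L; rewrite inE; apply/and3P/imsetP => [[mL /eqP Lk vL]|[a]].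
    have [|a lt_a e] := max_clique_block mL vL; first by rewrite Lk.
    have lt_a' : a < size sh by rewrite -szss.
    by exists (Ordinal lt_a'); rewrite ?inE //= -card_block // -e Lk.
  rewrite inE => /eqP ak ->; have lt_a : a < size ss by rewrite szss.
  by split; rewrite ?setU11 ?block_max_clique // card_block ?ak.
rewrite card_in_imset => [|a b _ _ e]; last first.
  have [|x xa] := @block_neq0 a; first by rewrite szss.
  have : x \in block b by rewrite -e !inE xa orbT.
  rewrite !inE => /orP[/eqP ex|xb]; last by apply: val_inj; apply: block_unique xa xb.
  by move: (notin_block a); rewrite -ex xa.
rewrite /line_quota count_map -[in RHS](mkseq_nth 0 sh) count_map -val_enum_ord.
rewrite count_map enumT cardE size_filter.
by apply: eq_count => a /=; rewrite inE.
Qed.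

End Blocks.

Lemma good_card_max_cliques v k : good sh G v -> 1 < k ->
  #|[set L | max_clique L & (#|L| == k) && (v \in L)]| = line_quota k.
Proof. by move=> [ss [e u m b]]; apply: (@card_max_cliques v ss). Qed.

Lemma good_edge_max_clique v x : good sh G v -> adj G v x ->
  exists L, [/\ max_clique L, v \in L & x \in L].
Proof.
move=> [ss [e u m b]]; rewrite -m => /flattenP[_ /(nthP [::])[a lt_a <-] xa].
exists (block v ss a); split; last by rewrite !inE xa orbT.
  exact: block_max_clique.
exact: setU11.
Qed.

Definition bad_set := [set v | ~~ `[< good sh G v >]].

Definition clique_lines :=
  [set L | [&& max_clique L, 1 < #|L| & [disjoint L & bad_set]]].

Lemma notin_bad v : v \notin bad_set -> good sh G v.
Proof. by rewrite inE negbK => /asboolP. Qed.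

Lemma clique_lines_good L x : L \in clique_lines -> x \in L -> x \notin bad_set.
Proof. by rewrite inE => /and3P[_ _ d] xL; rewrite (disjointFr d xL). Qed.

Lemma clique_lines_max L : L \in clique_lines -> max_clique L.
Proof. by rewrite inE => /and3P[]. Qed.

Lemma line_quota_small k : k <= 1 -> line_quota k = 0.
Proof.
move=> k1; apply/eqP; rewrite eqn0Ngt; apply/negP => /line_quota_support.
by rewrite ltnNge k1.
Qed.

(** Lines meet in good vertices only, where [good_max_clique_unique] applies. The lines through a
    good vertex are among its maximal cliques, and no line passes through a bad one. *)
Lemma clique_lines_admissible : admissible line_quota clique_lines.
Proof.
split=> [L1 L2 x y z F1 F2 x1 y1 y2 z2 xy yz n|L|k x].
- have gy := notin_bad (clique_lines_good F1 y1).
  apply: (good_max_clique_unique gy (clique_lines_max F1) (clique_lines_max F2)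
            y1 y2 x1 z2) => //; first by rewrite eq_sym.
  case/orP: n => [->//|/existsP[L /andP[LF /andP[xL zL]]]].
  by case: eqVneq => //= xz; rewrite (max_clique_adj (clique_lines_max LF)).
- by rewrite inE => /and3P[].
have [k1|k1] := leqP k 1.
  rewrite (line_quota_small k1) leqn0 cards_eq0; apply/eqP/setP => L; rewrite !inE.
  by apply/negbTE/negP => /and3P[/and3P[_ L1 _] /eqP Lk _];
    move: L1; rewrite Lk ltnNge k1.
have [xb|xb] := boolP (x \in bad_set).
  rewrite [line_count _ _ _](_ : _ = 0) //.
  apply/eqP; rewrite cards_eq0; apply/eqP/setP => L; rewrite in_set0 inE.
  apply/negbTE/negP => /and3P[LF _ xL].
  by have := clique_lines_good LF xL; rewrite xb.
rewrite -(good_card_max_cliques (notin_bad xb) k1); apply: subset_leq_card.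
apply/subsetP => L; rewrite inE => /andP[/clique_lines_max mL kL].
by rewrite inE mL.
Qed.

(** A maximal clique through a vertex outside this set contains no bad vertex, so no line is lost
    there. *)
Definition dubious := bad_set :|: \bigcup_(y in bad_set) [set x | adj G y x].

Lemma clique_line_count k x : x \notin dubious ->
  line_count clique_lines k x = line_quota k.
Proof.
move=> xU; have [_ F2 le_c] := clique_lines_admissible.
have [k1|k1] := leqP k 1.
  by apply/eqP; rewrite eqn_leq le_c (line_quota_small k1).
have xb : x \notin bad_set by apply: contra xU => xb; rewrite in_setU xb.
rewrite -(good_card_max_cliques (notin_bad xb) k1); congr #|pred_of_set _|.
apply/setP => L; rewrite [in LHS]inE [in RHS]inE inE.
case mL: (max_clique L) => //=; case: eqP => Lk; rewrite ?andbF //=.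
case xL: (x \in L); rewrite ?andbF //= Lk k1 /= andbT.
apply/pred0P => y /=; apply/negbTE/negP => /andP[yL yb].
have [e|xy] := eqVneq x y; first by rewrite e yb in xb.
case/negP: xU; rewrite in_setU (negbTE xb) /=; apply/bigcupP; exists y => //.
by rewrite inE adj_sym (max_clique_adj mL).
Qed.

Variable d : nat.
Hypothesis degG : max_degree_le d G.

Lemma card_dubious : #|dubious| <= d.+1 * #|bad_set|.
Proof.
apply: leq_trans (leq_card_setU _ _) _; rewrite mulSn leq_add2l.
apply: leq_trans (card_bigcup_le _ _) _; rewrite mulnC -sum_nat_const.
by apply: leq_sum => y _; apply: degG.
Qed.

Definition quota_sum := lines_per_point line_quota size_bound.

(** Only dubious vertices lack lines, each at most [quota_sum] of them. *)
Lemma clique_lines_deficiency :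
  deficiency line_quota size_bound clique_lines
    <= quota_sum * (d.+1 * #|bad_set|).
Proof.
rewrite /deficiency exchange_big /= (bigID (mem dubious)) /=.
rewrite [X in _ + X]big1 ?addn0; last first.
  by move=> x xU; apply: big1 => k _; rewrite clique_line_count ?subnn.
apply: (@leq_trans (\sum_(x in dubious) quota_sum)).
  by apply: leq_sum => x _; apply: leq_sum => k _; rewrite leq_subr.
by rewrite sum_nat_const mulnC leq_mul2l card_dubious orbT.
Qed.

(** Every vertex has its quota, so the product counts the incidences with [k]-point lines. *)
Lemma good_dvdn : bad_set = set0 -> forall k, k %| #|T| * line_quota k.
Proof.
move=> b0 k; have U0 : dubious = set0 by rewrite /dubious b0 big_set0 setU0.
rewrite -sum_nat_const (eq_bigr (line_count clique_lines k)).
  by rewrite sum_line_count dvdn_mulr.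
by move=> x _; rewrite clique_line_count // U0 inE.
Qed.

(** A changed edge has a dubious endpoint ([E1]) or lies on a line belonging to just one of the two
    systems ([E2]). *)
Lemma edit_line_graph F : admissible line_quota F ->
  edit_distance G (line_graph F) <= d.+1 * #|bad_set| * d +
    #|(clique_lines :\: F) :|: (F :\: clique_lines)| * 2 ^ size_bound.
Proof.
move=> aF; pose D := (clique_lines :\: F) :|: (F :\: clique_lines).
pose E1 := \bigcup_(x in dubious) [set [set x; y] | y in [set y | adj G x y]].
pose E2 := \bigcup_(L in D) powerset L.
have sizeL L : L \in D -> #|L| <= size_bound.
  case/setUP => /setDP[LF _]; apply: ltnW.
    exact: (admissible_line_size line_quota_support clique_lines_admissible LF).
  exact: (admissible_line_size line_quota_support aF LF).
have cE1 : #|E1| <= d.+1 * #|bad_set| * d.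
  apply: leq_trans (card_bigcup_le _ _) _.
  apply: (@leq_trans (\sum_(x in dubious) d)).
    by apply: leq_sum => x _; apply: leq_trans (leq_imset_card _ _) (degG x).
  by rewrite sum_nat_const leq_mul2r card_dubious orbT.
have cE2 : #|E2| <= #|D| * 2 ^ size_bound.
  apply: leq_trans (card_bigcup_le _ _) _; rewrite -sum_nat_const.
  by apply: leq_sum => L LD; rewrite card_powerset leq_exp2l // sizeL.
apply: leq_trans (leq_add cE1 cE2); apply: leq_trans (leq_card_setU _ _).
apply: subset_leq_card; apply/subsetP => e /setUP[] /setDP[].
  case/imsetP => -[x y]; rewrite inE /= => xy -> nH.
  have [xU|xU] := boolP (x \in dubious).
    by apply/setUP; left; apply/bigcupP; exists x => //; apply: imset_f; rewrite inE.
  have gx : x \notin bad_set by apply: contra xU => xb; rewrite in_setU xb.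
  have [L [mL xL yL]] := good_edge_max_clique (notin_bad gx) xy.
  have xny : x != y by apply: contraTneq xy => ->; rewrite adj_irr.
  have LF : L \in clique_lines.
    rewrite inE mL /=; apply/andP; split.
      by rewrite (cardsD1 x) xL ltnS; apply/card_gt0P; exists y; rewrite !inE eq_sym xny.
    apply/pred0P => z /=; apply/negbTE/negP => /andP[zL zb].
    have [ez|xz] := eqVneq x z; first by rewrite ez zb in gx.
    case/negP: xU; rewrite in_setU (negbTE gx) /=; apply/bigcupP; exists z => //.
    by rewrite inE adj_sym (max_clique_adj mL).
  apply/setUP; right; apply/bigcupP; exists L; last first.
    by rewrite inE; apply/subsetP => z /set2P[]->.
  rewrite !inE in LF *; rewrite LF andbT /= orbF.
  apply: contra nH => LF'; apply/imsetP; exists (x, y) => //.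
  by rewrite inE /= /line_adj xny; apply/existsP; exists L; rewrite LF' xL.
case/imsetP => -[x y]; rewrite inE /= => /andP[xny /existsP[L]].
case/andP=> LF /andP[xL yL] -> nG.
apply/setUP; right; apply/bigcupP; exists L; last first.
  by rewrite inE; apply/subsetP => z /set2P[]->.
rewrite in_setU !in_setD LF andbT /=.
apply: contra nG => LF0; apply/imsetP; exists (x, y) => //.
by rewrite inE /= (max_clique_adj (clique_lines_max LF0)).
Qed.

(** The first two summands provide the room that [completion] needs. The parenthesis bounds the
    edits at dubious vertices and on changed lines. The final 1 makes the cost positive. *)
Definition repair_cost := switch_bound line_quota size_bound +
  quota_sum * d.+1 +
  (d.+1 * d + size_bound.*2 * (quota_sum * d.+1) * 2 ^ size_bound) + 1.

Lemma repair : 0 < #|bad_set| -> repair_cost * #|bad_set| < #|T| ->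
  (forall k, k %| #|T| * line_quota k) ->
  exists2 H : sgraph T, forall v, good sh H v
    & edit_distance G H <= repair_cost * #|bad_set|.
Proof.
move=> b0 big dvd; set b := #|bad_set| in b0 big *.
have le_def := clique_lines_deficiency.
have := @completion T line_quota size_bound line_quota_support _ clique_lines
  clique_lines_admissible dvd le_def.
case=> [|F [aF Fc diff]].
  apply: leq_ltn_trans big; apply: leq_trans (leq_add (leqnn _) le_def) _.
  rewrite -/b; set S := switch_bound _ _.
  apply: (@leq_trans ((S + quota_sum * d.+1) * b)).
    by rewrite mulnDl -mulnA leq_add2r leq_pmulr.
  by rewrite /repair_cost leq_mul2r -[X in _ || (_ <= X)]addnA leq_addr orbT.
exists (line_graph F) => [v|].
  by case: aF => tF F2 _; apply: line_graph_good.
apply: leq_trans (edit_line_graph aF) _; rewrite -/b.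
have := leq_mul diff (leqnn (2 ^ size_bound)); rewrite -/b.
rewrite /repair_cost; set P := 2 ^ _; set Q := quota_sum; set X := #|_|.
set W := size_bound.*2; set S := switch_bound _ _; nia.
Qed.

End CliqueLines.
End Repair.

(** * The tester *)

Section Machine.
Variables (leeps : nat -> nat -> bool) (query : nat -> nat -> nat).
Implicit Types (p : prog) (m : memory) (c : config) (b : bool) (q : rat).

(** Halting is part of the claim: extra time then leaves the probability unchanged, and time budgets
    can be rounded up. *)
Definition wins t b q c :=
  halts_within leeps query t c && (q <= pr_verdict leeps query b t c)%R.

Lemma halts_withinS t c : halts_within leeps query t c ->
  halts_within leeps query t.+1 c.
Proof.
elim: t c => [|t IH] c; first by rewrite /= orbF => ->.
move=> h; change (halted c || all (halts_within leeps query t.+1)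
  (step leeps query c)).
move: h; rewrite [halts_within _ _ t.+1 c]/=; case: (halted c) => //=.
exact: sub_all.
Qed.

Lemma pr_verdictS b t c : halts_within leeps query t c ->
  pr_verdict leeps query b t.+1 c = pr_verdict leeps query b t c.
Proof.
have prS u d : pr_verdict leeps query b u.+1 d = if halted d then
    (verdict d == b)%:R%R else ((\sum_(d' <- step leeps query d)
    pr_verdict leeps query b u d') / (size (step leeps query d))%:R)%R by [].
elim: t c => [|t IH] c; first by rewrite /= orbF => ->.
rewrite [pr_verdict _ _ _ t.+2 _]prS [in RHS]prS.
rewrite [halts_within _ _ t.+1 c]/=; case: (halted c) => //; rewrite orFb => all_h.
congr (_ / _)%R.
elim: (step leeps query c) all_h => [|c' s IHs]; first by rewrite !big_nil.
rewrite [all _ _]/= => /andP[hc hs]; by rewrite !big_cons IHs // IH.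
Qed.

Lemma wins_leq t t' b q c : t <= t' -> wins t b q c -> wins t' b q c.
Proof.
move=> /subnK <-; elim: (t' - t) => // k IH /IH /andP[h1 h2].
by rewrite addSn /wins halts_withinS // pr_verdictS.
Qed.

Lemma wins_step t b q p k m c' :
  step leeps query (p :: k, m) = [:: c'] -> wins t b q c' ->
  wins t.+1 b q (p :: k, m).
Proof.
move=> e /andP[h1 h2]; rewrite /wins /= e /= h1 /=.
by rewrite big_seq1 divr1.
Qed.

(** Condition on the number drawn: [q] is at most the average of the bounds [f r]. *)
Lemma wins_random t b q k m x y (f : nat -> rat) :
  (forall r, wins t b (f r) (k, update m x r)) ->
  (q * (maxn 1 (m y))%:R <= \sum_(0 <= r < maxn 1 (m y)) f r)%R ->
  wins t.+1 b q (Random x y :: k, m).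
Proof.
move=> wf le_q; rewrite /wins /= all_map size_map size_iota; apply/andP; split.
  by apply/allP => r _ /=; case/andP: (wf r).
rewrite ler_pdivlMr ?ltr0n ?leq_max //; apply: le_trans le_q _.
rewrite big_map /index_iota subn0; apply: ler_sum => r _.
by case/andP: (wf r).
Qed.

(** [Random] is excluded as well, so there is a single run, whose final memory is given by
    [exec]. *)
Fixpoint loopfree p : bool :=
  match p with
  | Random _ _ | While _ _ => false
  | Seq p1 p2 | If _ p1 p2 => loopfree p1 && loopfree p2
  | _ => true
  end.

Fixpoint cost p : nat :=
  match p with
  | Seq p1 p2 | If _ p1 p2 => (cost p1 + cost p2).+1
  | _ => 1
  end.

Fixpoint exec p m : memory :=
  match p with
  | Const x a => update m x a
  | Arith o x y z => update m x (binop_eval o (m y) (m z))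
  | Read x y => update m x (m (m y))
  | Write x y => update m (m x) (m y)
  | Query x y z => update m x (query (m y) (m z))
  | LeEps x y z => update m x (leeps (m y) (m z))
  | Seq p1 p2 => exec p2 (exec p1 m)
  | If x p1 p2 => if m x != 0 then exec p1 m else exec p2 m
  | _ => m
  end.

Lemma wins_exec p t b q k m : loopfree p -> wins t b q (k, exec p m) ->
  wins (t + cost p) b q (p :: k, m).
Proof.
elim: p t k m => 
  [|x a|o x y z|x y|x y|x y|x y z|x y z|p1 IH1 p2 IH2|x p1 IH1 p2 IH2|x p IH]
  t k m //=; try by rewrite addn1 => _; apply: wins_step.
- case/andP=> l1 l2 w; rewrite addnS; apply: wins_step; first by [].
  by rewrite (addnC (cost p1)) addnA; apply: IH1 => //; apply: IH2.
case/andP=> l1 l2 w; rewrite addnS; apply: wins_step; first by [].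
case: (m x != 0) w => w.
  by apply: wins_leq (IH1 _ _ _ l1 w); rewrite leq_add2l leq_addr.
by apply: wins_leq (IH2 _ _ _ l2 w); rewrite leq_add2l leq_addl.
Qed.

(** Cell 4 holds the starting vertex and cell 1 the constant 1, so the multiplication is a copy.
    Cell 5 holds the query index. *)
Definition walk x (w : seq nat) : prog :=
  foldl (fun p i => Seq p (Seq (Const 5 i) (Query x x 5)))
    (Arith OpMul x 4 1) w.

Lemma loopfree_walk x w : loopfree (walk x w).
Proof. by elim/last_ind: w => // w i IH; rewrite /walk foldl_rcons /= IH. Qed.

Lemma exec_walk x w m : m 1 = 1 -> x != 5 ->
  exec (walk x w) m x = foldl query (m 4) w /\
  forall y, y != x -> y != 5 -> exec (walk x w) m y = m y.
Proof.
move=> m1 x5; elim/last_ind: w => [|w i [IH1 IH2]].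
  rewrite /= /update eqxx m1 muln1; split=> // y yx _.
  by rewrite (negbTE yx).
rewrite /walk !foldl_rcons -/(walk x w) /= /update !eqxx (negbTE x5) IH1.
split=> // y yx y5; rewrite (negbTE yx) (negbTE y5).
exact: IH2.
Qed.

(* A test compares the endpoints of two walks from the vertex in cell 4; a
   walk is given by the indices of the queries. *)
Definition test := (seq nat * seq nat)%type.

Definition holds (v : nat) (t : test) :=
  foldl query v t.1 == foldl query v t.2.

(** Cell 10 receives the sum of both truncated differences, which is 0 exactly if the endpoints
    agree. *)
Definition test_code (t : test) : prog :=
  Seq (walk 8 t.1) (Seq (walk 9 t.2) (Seq (Arith OpSub 10 8 9)
    (Seq (Arith OpSub 9 9 8) (Arith OpAdd 10 10 9)))).

Definition scratch := [:: 5; 6; 8; 9; 10].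

Lemma exec_test t m : m 1 = 1 ->
  (exec (test_code t) m 10 == 0) = holds (m 4) t /\
  forall y, y \notin scratch -> exec (test_code t) m y = m y.
Proof.
move=> m1; have [a1 a2] := exec_walk (x := 8) t.1 m1 isT.
set m' := exec (walk 8 t.1) m in a1 a2.
have m'1 : m' 1 = 1 by rewrite a2.
have [b1 b2] := exec_walk (x := 9) t.2 m'1 isT.
rewrite /= -/m'; set m'' := exec (walk 9 t.2) m' in b1 b2 *.
rewrite /update /= b1 b2 // a1 a2 // /holds; split.
  by rewrite addn_eq0 !subn_eq0 -eqn_leq.
move=> y; rewrite !inE !negb_or => /and5P[y5 y6 y8 y9 y10].
by rewrite (negbTE y9) (negbTE y10) b2 // a2.
Qed.

(** Compiles any Boolean function [g] of the test outcomes into a decision tree: [g] is evaluated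
    when the program is built, and each leaf is a constant. *)
Fixpoint decide (ts : seq test) (g : (test -> bool) -> bool) : prog :=
  if ts is t :: ts' then
    Seq (test_code t) (If 10
      (decide ts' (fun ev => g (fun t' => (t' != t) && ev t')))
      (decide ts' (fun ev => g (fun t' => (t' == t) || ev t'))))
  else Const 6 (g (fun=> false)).

Lemma loopfree_decide ts g : loopfree (decide ts g).
Proof. by elim: ts g => //= t ts IH g; rewrite !loopfree_walk !IH. Qed.

Lemma exec_decide ts g m : m 1 = 1 ->
  exec (decide ts g) m 6 = g (fun t => (t \in ts) && holds (m 4) t) /\
  forall y, y \notin scratch -> exec (decide ts g) m y = m y.
Proof.
elim: ts g m => [|t ts IH] g m m1.
  split=> [|y]; first by [].
  by rewrite !inE !negb_or /= /update => /and5P[_ /negbTE->].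
have [a1 a2] := exec_test t m1.
have -> : exec (decide (t :: ts) g) m = if exec (test_code t) m 10 != 0
    then exec (decide ts (fun ev => g (fun t' => (t' != t) && ev t')))
           (exec (test_code t) m)
    else exec (decide ts (fun ev => g (fun t' => (t' == t) || ev t')))
           (exec (test_code t) m) by [].
rewrite a1; set m' := exec (test_code t) m in a1 a2 *.
have m'1 : m' 1 = 1 by rewrite a2.
case h: (holds _ t); rewrite /=.
  have [b1 b2] := IH (fun ev => g (fun t' => (t' == t) || ev t')) m' m'1.
  split=> [|y ys]; last by rewrite b2 // a2.
  rewrite b1 a2 //; congr (nat_of_bool (g _)); apply: funext => t'.
  by rewrite inE; case: eqP => [->|].
have [b1 b2] := IH (fun ev => g (fun t' => (t' != t) && ev t')) m' m'1.
split=> [|y ys]; last by rewrite b2 // a2.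
rewrite b1 a2 //; congr (nat_of_bool (g _)); apply: funext => t'.
by rewrite inE; case: eqP => [->|]; rewrite /= ?h.
Qed.

(** * The sampling program *)

Section Tester.
Variables (d : nat) (sh : seq nat) (C n : nat).

(** The first tests detect that the [i]-th neighbour does not exist, the others that the [k]-th
    neighbour of the [i]-th neighbour is the [j]-th neighbour. *)
Definition tests : seq test :=
  [seq ([:: i], [:: d]) | i <- iota 0 d] ++
  [seq ([:: ik.1; ik.2], [:: j]) |
     ik <- [seq (i, k) | i <- iota 0 d, k <- iota 0 d], j <- iota 0 d].

(* The query with index d has no answer when the degree is at most d. *)
Definition checker (ev : test -> bool) : bool :=
  let sz := count (fun i => ~~ ev ([:: i], [:: d])) (iota 0 d) in
  (sz == sumn sh) && has (fun Is => all (fun i => all (fun j =>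
      has (fun k => ev ([:: nth 0 Is i; k], [:: nth 0 Is j])) (iota 0 d)
        == same_block sh i j) (iota 0 sz)) (iota 0 sz))
    (permutations (iota 0 sz)).

Definition check_vertex := decide tests checker.

Definition vertex_ok v := checker (fun t => (t \in tests) && holds v t).

(** Cell 6 is nonzero as long as the candidate in cell 7 is too small, so it controls the search
    loop. *)
Definition eps_test :=
  Seq (LeEps 6 1 7) (Arith OpSub 6 1 6).
Definition eps_body := Seq (Arith OpAdd 7 7 1) eps_test.

Definition sample_rest :=
  Seq check_vertex (Seq (Arith OpMul 2 2 6) (Arith OpSub 3 3 1)).
Definition sample_body := Seq (Random 4 0) sample_rest.

Definition div_test k :=
  Seq (Const 5 (line_quota sh k)) (Seq (Arith OpMul 8 0 5)
    (Seq (Const 5 k) (Seq (Arith OpMod 8 8 5) (If 8 (Const 2 0) Skip)))).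
Definition div_tests := foldr (fun k => Seq (div_test k)) Skip.
(** Cell 0 still holds [n]. The graph without vertices is accepted; otherwise the product with 1
    copies the flag from cell 2. *)
Definition finish := Seq (div_tests (iota 0 (size_bound sh)))
  (If 0 (Arith OpMul 0 2 1) (Const 0 1)).

(* Cell 0 holds n, cell 1 the constant 1, cell 2 whether all samples were good,
   cell 3 the number of samples still to be drawn, cell 4 the sampled vertex,
   cell 6 the result of the last test, and cell 7 the candidate for the least i
   with 1 <= eps * i. *)
Definition search_start := Seq (Const 1 1) (Seq (Const 7 1) eps_test).
Definition sample_start :=
  Seq (Const 5 C) (Seq (Arith OpMul 3 5 7) (Const 2 1)).

Definition tester := Seq search_start (Seq (While 6 eps_body)
  (Seq sample_start (Seq (While 3 sample_body) finish))).

Lemma loopfree_finish : loopfree finish.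
Proof. by rewrite /= andbT; elim: (iota _ _). Qed.

Lemma exec_div_tests ks m : m 1 = 1 ->
  let m' := exec (div_tests ks) m in
  [/\ m' 0 = m 0, m' 1 = 1
    & m' 2 = m 2 * all (fun k => k %| m 0 * line_quota sh k) ks].
Proof.
elim: ks m => [|k ks IH] m m1; first by rewrite /= muln1.
rewrite [exec _ _]/=; set m' := (X in exec (div_tests ks) X).
have [e0 e1 e2] : [/\ m' 0 = m 0, m' 1 = 1
    & m' 2 = m 2 * (k %| m 0 * line_quota sh k)].
  rewrite /m' /update /= /dvdn; case: eqP => _ /=; split=> //.
    by rewrite muln1.
  by rewrite muln0.
have [f0 f1 f2] := IH m' e1; rewrite e0 in f0 f2; split=> //.
by rewrite f2 e2 /= -mulnA mulnb.
Qed.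

Definition outcome (a : bool) :=
  (n == 0) || a &&
    all (fun k => k %| n * line_quota sh k) (iota 0 (size_bound sh)).

Lemma wins_finish b q m (a : bool) : m 0 = n -> m 1 = 1 -> m 2 = a ->
  (q <= (outcome a == b)%:R)%R ->
  wins (cost finish) b q ([:: finish], m).
Proof.
move=> m0 m1 m2 le_q; apply: (@wins_exec finish 0) loopfree_finish _.
rewrite /wins /=.
suff -> : verdict ([::], exec finish m) = outcome a by [].
rewrite /verdict /outcome /finish; move: (iota 0 _) => ks.
have [f0 f1 f2] := exec_div_tests ks m1; rewrite /=.
set m' := exec (div_tests _) m in f0 f1 f2 *.
rewrite f0 m0; case: (eqVneq n 0) => n0 //=.
rewrite /update /= f1 muln1 f2 m2 m0 mulnb.
by case: (_ && _).
Qed.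

Lemma wins_while x p t b q k m : m x != 0 -> wins t b q (p :: While x p :: k, m) ->
  wins t.+1 b q (While x p :: k, m).
Proof. by move=> mx w; apply: wins_step w; rewrite /step /= mx. Qed.

Lemma wins_while_end x p t b q k m : m x = 0 -> wins t b q (k, m) ->
  wins t.+1 b q (While x p :: k, m).
Proof. by move=> mx w; apply: wins_step w; rewrite /step /= mx. Qed.

Lemma wins_search t b q k j i m : m 1 = 1 -> m 0 = n -> m 7 = i ->
  m 6 = ~~ leeps 1 i -> leeps 1 (i + j) ->
  (forall i' m', m' 1 = 1 -> m' 0 = n -> m' 7 = i' -> leeps 1 i' ->
     i' <= i + j -> wins t b q (k, m')) ->
  wins (t + j * (cost eps_body).+1).+1 b q (While 6 eps_body :: k, m).
Proof.
elim: j i m => [|j IH] i m m1 m0 m7 m6 lt_ij wk.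
  rewrite addn0 in lt_ij wk; apply: wins_while_end; first by rewrite m6 lt_ij.
  by rewrite mul0n addn0; apply: (wk i).
have [le_i|nle_i] := boolP (leeps 1 i).
  apply: wins_while_end; first by rewrite m6 le_i.
  apply: (@wins_leq t); first exact: leq_addr.
  by apply: (wk i) => //; apply: leq_addr.
apply: wins_while; first by rewrite m6 nle_i.
apply: (@wins_leq ((t + j * (cost eps_body).+1).+1 + cost eps_body)).
  by rewrite mulSn; lia.
apply: wins_exec => //; apply: (IH i.+1) => //=; rewrite /update /= ?m7 ?m1 ?addn1 //.
- by case: (leeps 1 i.+1).
- by rewrite addSn -addnS.
by move=> i' m' *; apply: (wk i') => //; rewrite addnS -addSn.
Qed.

Lemma loopfree_sample : loopfree sample_rest.
Proof. by rewrite /= loopfree_decide. Qed.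

(* V s a bounds from below the probability of the wanted verdict when s
   samples remain and a tells whether all previous ones were good. *)
Variable V : nat -> bool -> rat.

Hypothesis V_step : forall s a, (V s.+1 a * (maxn 1 n)%:R <=
  \sum_(0 <= r < maxn 1 n) V s (a && vertex_ok r))%R.

Lemma wins_sample b s (a : bool) m : m 0 = n -> m 1 = 1 -> m 2 = a -> m 3 = s ->
  (forall a', V 0 a' <= (outcome a' == b)%:R)%R ->
  wins (cost finish + s * (cost sample_rest).+3).+1 b (V s a)
    ([:: While 3 sample_body; finish], m).
Proof.
move=> m0 m1 m2 m3 V0; elim: s a m m0 m1 m2 m3 => [|s IH] a m m0 m1 m2 m3.
  apply: wins_while_end => //; rewrite mul0n addn0.
  exact: (@wins_finish _ _ _ a).
apply: wins_while; first by rewrite m3.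
apply: (@wins_leq ((cost finish + s * (cost sample_rest).+3).+1
  + cost sample_rest).+2); first by rewrite mulSn; lia.
apply: (@wins_step _ _ _ _ _ _
  ([:: Random 4 0; sample_rest; While 3 sample_body; finish], m)) => //.
apply: (wins_random (f := fun r => V s (a && vertex_ok r))); last by rewrite m0.
move=> r; apply: wins_exec; first exact: loopfree_sample.
have [c1 c2] := @exec_decide tests checker (update m 4 r) m1.
rewrite /sample_rest; set m' := exec check_vertex (update m 4 r) in c1 c2.
rewrite [exec _ _]/= -/m'; apply: IH; rewrite /update /= ?c1 ?c2 //=.
- by rewrite /update /= m2 mulnb.
- by rewrite /update /= m3 m1 subn1.
Qed.

(** If [N] passes the comparison, the search stops at some [i <= N], and at most [C * N] samples are
    drawn. *)
Definition tester_time N := (cost finish + C * N * (cost sample_rest).+3).+1.+1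
  + cost sample_start + 1 + N * (cost eps_body).+1 + 3 + cost search_start.

Lemma tester_wins b q N : 0 < N -> leeps 1 N ->
  (forall a', V 0 a' <= (outcome a' == b)%:R)%R ->
  (forall i, leeps 1 i -> q <= V (C * i) true)%R ->
  wins (tester_time N) b q (initial tester n).
Proof.
case: N => // N _ leN V0 Vq.
pose t1 := (cost finish + C * N.+1 * (cost sample_rest).+3).+1.
apply: (@wins_leq (((((t1 + cost sample_start).+2 +
  N * (cost eps_body).+1).+1.+1 + cost search_start).+1))).
  by rewrite /tester_time -/t1 mulSn; lia.
apply: wins_step; first by [].
apply: wins_exec; first by [].
apply: wins_step; first by [].
apply: (@wins_search _ _ _ _ N 1) => //.
  by rewrite /= /update /=; case: (leeps 1 1).
move=> i m m1 m0 m7 le_i iN; apply: wins_step; first by [].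
rewrite -addSn; apply: wins_exec => //; apply: wins_step; first by [].
apply: (@wins_leq (cost finish + C * i * (cost sample_rest).+3).+1).
  by rewrite /t1 ltnS leq_add2l leq_mul2r leq_mul2l iN !orbT.
have /andP[h1 h2] : wins (cost finish + C * i * (cost sample_rest).+3).+1 b
    (V (C * i) true) ([:: While 3 sample_body; finish], exec sample_start m).
  by apply: wins_sample; rewrite /= /update //= m7.
by rewrite /wins h1 (le_trans (Vq i le_i) h2).
Qed.

End Tester.

End Machine.

(** * Correctness of the tester *)

Section VertexCheck.
Variables (d : nat) (sh : seq nat) (n : nat) (G : sgraph 'I_n).
Variable nbrs : 'I_n -> seq 'I_n.
Hypothesis degG : max_degree_le d G.
Hypothesis nbrsP : adjacency_lists G nbrs.

Lemma oracleE (v : 'I_n) i : oracle nbrs v i = nth n (map val (nbrs v)) i.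
Proof. by rewrite /oracle valK. Qed.

Lemma size_nbrs v : size (nbrs v) <= d.
Proof. by rewrite (perm_size (nbrsP v)) -cardE. Qed.

Lemma mem_nbrs u w : (w \in nbrs u) = adj G u w.
Proof. by rewrite (perm_mem (nbrsP u)) mem_enum inE. Qed.

Lemma vertex_ok_good (v : 'I_n) :
  vertex_ok (oracle nbrs) d sh v = `[< good sh G v >].
Proof.
set l := nbrs v; have szl : size l <= d := size_nbrs v.
rewrite /vertex_ok; set ev := (X in checker _ _ X).
have noneE j : size l <= j -> oracle nbrs v j = n.
  by move=> le_j; rewrite oracleE nth_default ?size_map.
have someE i : i < size l -> oracle nbrs v i = nth v l i.
  by move=> lt_i; rewrite oracleE (nth_map v).
have ev1 i : i < d -> ev ([:: i], [:: d]) = (size l <= i).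
  move=> lt_i; have it : ([:: i], [:: d]) \in tests d.
    rewrite mem_cat; apply/orP; left.
    by apply: (map_f (fun i => ([:: i], [:: d]))); rewrite mem_iota.
  rewrite /ev it /holds /= (noneE d) //.
  have [lt_il|le_li] := ltnP i (size l); last by rewrite noneE ?eqxx.
  by rewrite someE // ltn_eqF.
have ev2 i j : i < size l -> j < size l ->
    has (fun k => ev ([:: i; k], [:: j])) (iota 0 d) =
    adj G (nth v l i) (nth v l j).
  move=> lt_i lt_j; set u := nth v l i; set w := nth v l j.
  have evE k : k < d -> ev ([:: i; k], [:: j]) =
      (nth n (map val (nbrs u)) k == w).
    move=> lt_k; have it : ([:: i; k], [:: j]) \in tests d.
      rewrite mem_cat; apply/orP; right.
      apply: (allpairs_f (fun ik j => ([:: ik.1; ik.2], [:: j])) (x := (i, k))).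
        by apply: allpairs_f; rewrite mem_iota //= (leq_trans lt_i).
      by rewrite mem_iota /= (leq_trans lt_j).
    by rewrite /ev it /holds /= !someE // oracleE.
  rewrite -mem_nbrs -(mem_map val_inj); apply/hasP/idP => [[k]|wu].
    rewrite mem_iota /= => lt_k; rewrite evE // => /eqP e.
    (* An index beyond the list of [u] is answered by [n], which is not a vertex. *)
    rewrite -[X in X \in _]e mem_nth // ltnNge; apply/negP => le_k.
    by have := ltn_ord w; rewrite -e nth_default // ltnn.
  have lt_k : index (val w) (map val (nbrs u)) < d.
    by apply: leq_trans (size_nbrs u); rewrite -(size_map val) index_mem.
  exists (index (val w) (map val (nbrs u))); first by rewrite mem_iota.
  by rewrite evE // nth_index.
have cnt : count (fun i => ~~ ev ([:: i], [:: d])) (iota 0 d) = size l.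
  rewrite -(subnKC szl) iotaD count_cat add0n.
  rewrite (eq_in_count (a2 := predT)); last first.
    move=> i; rewrite mem_iota subnKC //= => lt_i.
    by rewrite ev1 ?(leq_trans lt_i) // -ltnNge lt_i.
  rewrite count_predT size_iota (eq_in_count (a2 := pred0)); last first.
    move=> i; rewrite mem_iota !subnKC // => /andP[le_i lt_i].
    by rewrite ev1 // le_i.
  by rewrite count_pred0 addn0.
rewrite /checker cnt; apply/andP/asboolP.
  case=> /eqP szE /hasP[Is]; rewrite mem_permutations => pI /allP ok.
  apply/(good_listP sh (nbrsP v)); split=> //; exists Is => // i j lt_i lt_j.
  have ltI k : k < size l -> nth 0 Is k < size l.
    move=> lt_k; have := mem_nth 0 (n := k) (s := Is).
    rewrite (perm_size pI) size_iota => /(_ lt_k).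
    by rewrite (perm_mem pI) mem_iota.
  have := ok i; rewrite mem_iota => /(_ lt_i)/allP/(_ j).
  by rewrite mem_iota => /(_ lt_j)/eqP <-; rewrite ev2 // ltI.
move/(good_listP sh (nbrsP v)) => [szE [Is pI pat]]; split; first exact/eqP.
apply/hasP; exists Is; first by rewrite mem_permutations.
apply/allP => i; rewrite mem_iota => lt_i; apply/allP => j.
rewrite mem_iota => lt_j.
have ltI k : k < size l -> nth 0 Is k < size l.
  move=> lt_k; have := mem_nth 0 (n := k) (s := Is).
  rewrite (perm_size pI) size_iota => /(_ lt_k).
  by rewrite (perm_mem pI) mem_iota.
by rewrite ev2 ?ltI // pat.
Qed.

End VertexCheck.

(** For [d = 0] the distance scale [eps * d * n] vanishes, so this case needs its own argument: all
    vertices are isolated, and all or none are good. *)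
Lemma degree0_good (sh : seq nat) (T : finType) (G : sgraph T) (v u : T) :
  0 \notin sh -> max_degree_le 0 G -> good sh G v -> good sh G u.
Proof.
move=> sh_pos deg0.
have adj0 x y : adj G x y = false.
  apply/negbTE/negP => xy; have := deg0 x; rewrite leqn0 cards_eq0 => /eqP/setP/(_ y).
  by rewrite !inE xy.
case=> ss [ssE _ mem _]; suff -> : sh = [::].
  by exists [::]; split=> // a b x y; rewrite nth_nil.
have : sumn sh = 0.
  rewrite -ssE -size_flatten; case: (flatten ss) mem => // x l /(_ x).
  by rewrite mem_head adj0.
case: (sh) sh_pos => // s sh' + /eqP; rewrite inE /= addn_eq0.
by case: s.
Qed.

(** It yields [(1 - x) ^+ s <= 1/3] once [s * x] is at least 2. *)
Lemma bernoulli_inv (F : realFieldType) (x : F) s : (0 <= x <= 1)%R ->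
  ((1 - x) ^+ s * (1 + s%:R * x) <= 1)%R.
Proof.
move=> x01; elim: s => [|s IH]; first by rewrite expr0 mul0r addr0 mulr1.
apply: le_trans IH; rewrite exprSr -mulrA; apply: ler_wpM2l.
  by apply: exprn_ge0; lra.
have := ler0n F s; rewrite -natr1; nra.
Qed.

Theorem theorem8p4 (R : realType) (d : nat) (tau : ball1 -> Prop)
    (tau_1type : is_1type tau)
    (tau_cliques : forall B : ball1, tau B ->
       disjoint_union_of_cliques (induced (ball_graph B) [set~ centre B])) :
  uniformly_testable_in_constant_time R d
    (fun (n : nat) (G : sgraph 'I_n) => nbhd_regular tau G).
Proof.
have [B0 tauE] := tau_1type.
have tauB0 : tau B0 by apply/tauE; exists id; split=> //; exists id.
have [ss [ss0 ssu ssm ssb]] := clique_ball_blocks (tau_cliques _ tauB0).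
set sh := shape ss in ss0.
have goodE n (G : sgraph 'I_n) v : good sh G v <-> tau (nbhd_ball G v).
  split=> [/(good_ball_iso (erefl sh) ssu ssm ssb)|] /tauE //.
  by move=> h; apply/(good_ball_iso (erefl sh) ssu ssm ssb).
(* The factor 2 makes the expected number of bad vertices among [C * i] samples at least 2 in the
   far case. *)
pose C := 2 * repair_cost sh d.
exists (tester d sh C), (fun eps => tester_time d sh C (Num.truncn (eps^-1)%R).+1).
move=> eps /andP[eps0 eps1] n G degG nbrs nbrsP; cbv zeta.
set N := (Num.truncn _).+1.
set leeps := eps_compare eps; set query := oracle nbrs.
have leN : leeps 1 N.
  rewrite /leeps /eps_compare mulrC -ler_pdivrMr // mul1r ltW //.
  exact: truncnS_gt.
pose bad := bad_set sh G.
pose dv := all (fun k => k %| n * line_quota sh k) (iota 0 (size_bound sh)).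
have wins_of b q V :
    (forall s a, (V s.+1 a * (maxn 1 n)%:R <=
       \sum_(0 <= r < maxn 1 n) V s (a && vertex_ok query d sh r))%R) ->
    (forall a, V 0 a <= (outcome sh n a == b)%:R)%R ->
    (forall i, leeps 1 i -> q <= V (C * i) true)%R ->
    wins leeps query (tester_time d sh C N) b q (initial (tester d sh C) n).
  by move=> VS V0 Vq; exact: (tester_wins VS _ leN V0 Vq).
have two_thirds : (2 / 3 <= 1 :> rat)%R by lra.
(* A uniform vertex is bad in [#|bad|] of the [n] cases, and then the flag becomes false. *)
have sumV (V : bool -> rat) a : 0 < n ->
    (\sum_(0 <= r < maxn 1 n) V (a && vertex_ok query d sh r) =
     V a * (n - #|bad|)%:R + V false * #|bad|%:R)%R.
  move=> n0; rewrite (maxn_idPr n0) big_mkord.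
  rewrite (bigID (mem bad)) /= addrC; congr (_ + _)%R.
    rewrite (eq_bigr (fun=> V a)) => [|v].
      rewrite sumr_const mulr_natr; congr (_ *+ _)%R.
      by rewrite -[X in _ = X - _](card_ord n) -(cardC (mem bad)) addKn.
    rewrite inE negbK (vertex_ok_good _ degG nbrsP) => ->.
    by rewrite andbT.
  rewrite (eq_bigr (fun=> V false)) => [|v].
    by rewrite sumr_const mulr_natr.
  by rewrite inE (vertex_ok_good _ degG nbrsP) => /negbTE->; rewrite andbF.
have dvP : dv -> forall k, k %| #|'I_n| * line_quota sh k.
  move=> /allP dvk k; rewrite card_ord.
  have [k0|] := posnP (line_quota sh k); first by rewrite k0 muln0.
  move=> /(line_quota_support ss0)/andP[_ kb].
  by apply: (dvk k); rewrite mem_iota.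
split.
- have /andP[] // : wins leeps query (tester_time d sh C N) true 0
    (initial (tester d sh C) n).
  apply: (@wins_of _ _ (fun _ _ => 0%R)) => // s a.
  by rewrite mul0r big1.
- move=> PG; have [n0|n0] := posnP n.
    have /andP[_] : wins leeps query (tester_time d sh C N) true (2 / 3)%R
        (initial (tester d sh C) n) => //.
    apply: (@wins_of _ _ (fun _ _ => 1%R)) => [s a|a|//].
      by rewrite mul1r sumr_const_nat subn0.
    by rewrite /outcome n0.
  have b0 : bad = set0.
    apply/setP => v; rewrite in_set0 inE; apply/negbTE; rewrite negbK.
    by apply/asboolP/goodE; apply: PG.
  have dv1 : dv.
    by apply/allP => k _; rewrite -(card_ord n); apply: (good_dvdn ss0 b0).
  have /andP[_] : wins leeps query (tester_time d sh C N) true (2 / 3)%R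
      (initial (tester d sh C) n) => //.
  apply: (@wins_of _ _ (fun _ a => a%:R)%R) => [s a|a|//].
    by rewrite (sumV (fun a => a%:R)%R) // b0 cards0 subn0 mul0r addr0 (maxn_idPr n0).
  by rewrite /outcome -/dv dv1 andbT (gtn_eqF n0) eqb_id.
move=> farG.
have nP : ~ nbhd_regular tau G.
  move=> PG; have := farG G PG; rewrite /edit_distance setDv setU0 cards0.
  by rewrite ltNge !mulr_ge0 // ltW.
have n0 : 0 < n.
  by rewrite lt0n; apply/eqP => n0; apply: nP => v;
    have := ltn_ord v; rewrite [X in _ < X]n0.
have b0 : 0 < #|bad|.
  rewrite card_gt0; apply/eqP => b0; apply: nP => v; apply/goodE/notin_bad.
  by rewrite -/bad b0 inE.
have bn : #|bad| <= n by rewrite -[X in _ <= X](card_ord n) max_card.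
(* If a divisibility fails, rejection is certain whatever the samples are. *)
have [dv1|dv0] := boolP dv; last first.
  have /andP[_] : wins leeps query (tester_time d sh C N) false (2 / 3)%R
      (initial (tester d sh C) n) => //.
  apply: (@wins_of _ _ (fun _ _ => 1%R)) => [s a|a|//].
    by rewrite mul1r sumr_const_nat subn0.
  by rewrite /outcome -/dv (negbTE dv0) andbF (gtn_eqF n0).
(* Otherwise [repair] applies, with at most [rb] edits. As [1 <= eps * i], [rb <= eps * rb * i < eps
   * n <= eps * d * n], so [G] would not be far. *)
have many i : leeps 1 i -> n <= repair_cost sh d * #|bad| * i.
  rewrite /leeps /eps_compare => le_i; rewrite leqNgt; apply/negP => lt_n.
  have i0 : 0 < i by case: i le_i {lt_n} => //; rewrite mulr0 ler10.
  have lt_n1 : repair_cost sh d * #|bad| < n.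
    by apply: leq_ltn_trans lt_n; rewrite leq_pmulr.
  have [|H gH] := repair ss0 degG b0 _ (dvP dv1); first by rewrite card_ord.
  have PH : nbhd_regular tau H by move=> v; apply/goodE.
  have := farG H PH; rewrite -/bad => lt_e le_e.
  have rc0 : 0 < repair_cost sh d by rewrite /repair_cost addn1.
  (* With [d = 0] all vertices would be bad, as one is, but there are too few bad ones. *)
  have d0 : 0 < d.
    rewrite lt0n; apply/eqP => d0; rewrite d0 in degG.
    have [v /notin_bad gv] : exists v, v \notin bad.
      apply/existsP; rewrite -negb_forall; apply/negP => /forallP all_bad.
      have bT : bad = setT by apply/setP => v; rewrite all_bad inE.
      by move: lt_n1; rewrite bT cardsT card_ord ltnNge leq_pmull.
    case/card_gt0P: b0 => u; rewrite inE => /asboolP; apply.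
    exact: degree0_good ss0 degG gv.
  set rb := (repair_cost sh d * #|bad|)%N in lt_n le_e.
  have le_eR : ((edit_distance G H)%:R <= rb%:R :> R)%R by rewrite ler_nat.
  have lt_nR : (rb%:R * i%:R < n%:R :> R)%R by rewrite -natrM ltr_nat.
  have d1 : (1 <= d%:R :> R)%R by rewrite ler1n.
  have n0R := ltr0n R n; rewrite n0 in n0R.
  have le1 : (rb%:R <= eps * (rb%:R * i%:R) :> R)%R.
    by rewrite mulrCA ler_peMr // ler0n.
  have le2 : (eps * (rb%:R * i%:R) < eps * n%:R)%R by rewrite ltr_pM2l.
  have le3 : (eps * n%:R <= eps * d%:R * n%:R)%R.
    by rewrite -mulrA ler_pM2l // ler_peMl // ltW.
  lra.
pose x : rat := (#|bad|%:R / n%:R)%R.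
have n0R : (0 < n%:R :> rat)%R by rewrite ltr0n.
have xE : (#|bad|%:R = n%:R * x)%R by rewrite mulrC divfK // lt0r_neq0.
have x01 : (0 <= x <= 1)%R.
  by rewrite divr_ge0 //= ler_pdivrMr // mul1r ler_nat.
have /andP[_] : wins leeps query (tester_time d sh C N) false (2 / 3)%R
    (initial (tester d sh C) n) => //.
(* The probability that [s] independent samples hit a bad vertex, or 1 if one has been hit
   already. *)
pose V s (a : bool) : rat := (if a then 1 - (1 - x) ^+ s else 1)%R.
apply: (@wins_of _ _ V) => [s a|a|i le_i].
- rewrite (sumV (V s)) // natrB // xE (maxn_idPr n0).
  case: a; rewrite /V ?exprS; last by lra.
  by move: (_ ^+ s)%R => y; rewrite le_eqVlt; apply/orP; left; apply/eqP; ring.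
- case: a; rewrite /V ?expr0 ?subrr ?ler0n //.
  by rewrite /outcome (gtn_eqF n0).
rewrite /V; have := bernoulli_inv (C * i) x01.
have : (0 <= (1 - x) ^+ (C * i))%R by apply: exprn_ge0; lra.
have : (2 <= (C * i)%:R * x)%R.
  rewrite mulrA ler_pdivlMr // -!natrM ler_nat /C.
  by rewrite -!mulnA leq_pmul2l // (mulnC i) mulnA many.
move: ((C * i)%:R * x)%R ((1 - x) ^+ (C * i))%R => y z; nra.
Qed.
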